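(* Let $P$ be a probability distribution on $\mathbb{R}^d$, let $m\in(0,1)$ and fix $x\in\mathbb{R}^d$. Assume that $F_x$ is differentiable at $F_x^{-1}(m)$ with positive derivative $F_x'(F_x^{-1}(m))$. Then, as $n\to\infty$, $$\sqrt{n}\,\bigl(\hat\delta^2(x)-\delta^2(x)\bigr)\rightsquigarrow N(0,\sigma_x^2),$$ where $$\sigma_x^2=\frac{1}{m^2}\int_0^{F_x^{-1}(m)}\int_0^{F_x^{-1}(m)}\bigl[F_x(s\wedge t)-F_x(s)F_x(t)\bigr]\,ds\,dt .$$
   Context: For a probability measure $\mu$ on $\mathbb{R}^d$ and $x\in\mathbb{R}^d$ let $F_{\mu,x}(t)=\mu(\{y:\|y-x\|^2\le t\})$ be the cdf of the squared distance to $x$, and let $F_{\mu,x}^{-1}(u)=\inf\{t:F_{\mu,x}(t)\ge u\}$ for $u\in(0,1)$. For $m\in(0,1)$ the distance-to-measure (DTM) of $\mu$ at resolution $m$ is the nonnegative function $\delta_{\mu,m}$ with $$\delta_{\mu,m}^2(x)=\frac1m\int_0^m F_{\mu,x}^{-1}(u)\,du .$$ Write $F_x=F_{P,x}$ and $\delta=\delta_{P,m}$. Let $X_1,\dots,X_n$ be an i.i.d. sample from $P$, let $P_n=\frac1n\sum_{i=1}^n\delta_{X_i}$ be the empirical measure (mass $1/n$ at each $X_i$), and let $\hat\delta=\delta_{P_n,m}$. The symbol $\rightsquigarrow$ denotes convergence in distribution. *)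

(* Defs.v *)
From HB Require Import structures.
From mathcomp Require Import all_boot all_order all_algebra finmap.
From mathcomp Require Import all_classical all_reals all_analysis.

Set Implicit Arguments.
Unset Strict Implicit.
Unset Printing Implicit Defensive.

Import Order.TTheory GRing.Theory Num.Theory.
Import numFieldNormedType.Exports.

Local Open Scope classical_set_scope.
Local Open Scope ring_scope.

(* R^d is [d.-tuple R], whose measurable structure is the product sigma-algebra,
   that is, the Borel sigma-algebra of R^d. *)

Definition sqdist (R : realType) (d : nat) (x y : d.-tuple R) : R :=
  \sum_(i < d) (tnth y i - tnth x i) ^+ 2.

Definition sqdist_cdf (R : realType) (d : nat)
    (mu : {measure set (d.-tuple R) -> \bar R}) (x : d.-tuple R) (t : R) : R :=
  fine (mu [set y | sqdist x y <= t]).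

(* When mu is a probability measure and 0 < u < 1, the set is nonempty and
   bounded below by 0, so that [inf] is the true infimum. *)
Definition sqdist_quantile (R : realType) (d : nat)
    (mu : {measure set (d.-tuple R) -> \bar R}) (x : d.-tuple R) (u : R) : R :=
  inf [set t | u <= sqdist_cdf mu x t].

Definition dtm (R : realType) (d : nat)
    (mu : {measure set (d.-tuple R) -> \bar R}) (m : R) (x : d.-tuple R) : R :=
  Num.sqrt (m^-1 *
    \int[lebesgue_measure]_(u in `]0, m[) sqdist_quantile mu x u).

(* The empirical measure of the first n terms of a sequence of points (the zero
   measure when n = 0). *)
Definition empirical (R : realType) (d : nat) (y : nat -> d.-tuple R) (n : nat)
    : {measure set (d.-tuple R) -> \bar R} :=
  mscale ((n%:R : R)^-1)%:nng (msum (fun i => \d_(y i)) n).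

Definition mutually_independent (R : realType) (disp disp' : measure_display)
    (Omega : measurableType disp) (T : measurableType disp')
    (Pr : probability Omega R) (X : nat -> {RV Pr >-> T}) : Prop :=
  forall (J : {fset nat}) (A : nat -> set T),
    (forall i, i \in J -> measurable (A i)) ->
    Pr (\bigcap_(i in [set` J]) (X i @^-1` A i)) =
      (\prod_(i <- J) Pr (X i @^-1` A i))%E.

Definition iid (R : realType) (disp disp' : measure_display)
    (Omega : measurableType disp) (T : measurableType disp')
    (Pr : probability Omega R) (P : probability T R)
    (X : nat -> {RV Pr >-> T}) : Prop :=
  (forall i A, measurable A -> distribution Pr (X i) A = P A) /\
  mutually_independent X.

(* The Z n are real random variables whose distribution functions converge to
   that of nu at each of its continuity points. *)
Definition cvg_in_distribution (R : realType) (disp : measure_display)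
    (Omega : measurableType disp) (Pr : probability Omega R)
    (Z : nat -> Omega -> R) (nu : probability (measurableTypeR R) R) : Prop :=
  (forall n, measurable_fun [set: Omega] (Z n)) /\
  forall t : R, {for t, continuous (fun s : R => nu `]-oo, s]%classic)} ->
    Pr [set w | Z n w <= t] @[n --> \oo] --> nu `]-oo, t]%classic.

Definition dtm_variance (R : realType) (d : nat)
    (P : {measure set (d.-tuple R) -> \bar R}) (m : R) (x : d.-tuple R) : R :=
  let F := sqdist_cdf P x in
  let q := sqdist_quantile P x m in
  (m ^+ 2)^-1 *
    \int[lebesgue_measure]_(t in `[0, q])
      \int[lebesgue_measure]_(s in `[0, q])
        (F (Num.min s t) - F s * F t).

(* Main.v *)
Require Import Defs.
From HB Require Import structures.
From mathcomp Require Import all_boot all_order all_algebra finmap.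
From mathcomp Require Import all_classical all_reals all_analysis.
From mathcomp Require Import measurable_realfun ring lra.

Set Implicit Arguments.
Unset Strict Implicit.
Unset Printing Implicit Defensive.

Import Order.TTheory GRing.Theory Num.Theory.
Import numFieldNormedType.Exports.

Local Open Scope classical_set_scope.
Local Open Scope ring_scope.

(** Write [Y] for the squared distance to [x] and [G t = m t - E max(0, t - Y)].
   [G] is concave with right derivative [m - F t], its maximum is attained at
   the quantile [q] of order [m], and the layer cake formula shows that this
   maximum is [m] times the squared distance to measure. This holds for [P] as
   well as for the empirical measure, whose function [G_n] satisfies
   [0 <= max G_n - G_n q <= e |m - F_n q|] as soon as
   [F_n (q - e) < m <= F_n (q + e)]. By Chebyshev's inequality the error of
   replacing [max G_n] by [G_n q] is therefore o(n^-1/2) in probability, without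
   any control on the empirical quantile process.

   What remains, [G_n q - G q], is a centered mean of bounded i.i.d. variables.
   Its central limit theorem is proved by Stein's method: if
   [s^2 f'(z) - z f(z) = h z - E h(N(0, s^2))], then [E h(S_n) - E h(N(0, s^2))]
   is computed by a Taylor expansion of [f] around the sum with one term
   removed, which is independent of the removed term. *)

(** The error of replacing [max G_n] by [G_n q] is small for two reasons at once: [|m - F_n q|] is
    already of order n^-1/2, because continuity of [F] at [q] forces [F q = m], and the factor [e]
    is at our disposal. The positive derivative provides [F (q - e) < m < F (q + e)], so that [F_n]
    brackets [m] at these two points with probability tending to 1.

    No moment of [Y] is assumed. Every variable that is averaged is a hinge [max(0, t - Y)] or the
    indicator of [Y <= t], both bounded; hence the class [bounded_mfun], which is stable under ring
    operations and integrable under any probability.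

    Stein's equation divides by [s^2], so the limit variance has to be shown positive beforehand;
    this comes from mass [1 - m] beyond [q] and from mass strictly below [q]. The equation is solved
    for Lipschitz [h] with values in [0, 1]; distribution functions are then reached by squeezing
    indicators between piecewise linear ramps. *)

(** * Bounded measurable functions *)

Definition bounded_mfun (R : realType) (d : measure_display)
    (T : measurableType d) (f : T -> R) : Prop :=
  measurable_fun [set: T] f /\ exists M, forall x, `|f x| <= M.

Section bounded_mfun.
Context {R : realType} {d : measure_display} {T : measurableType d}.
Implicit Types f g : T -> R.

Lemma bounded_mfun_cst (r : R) : bounded_mfun (fun _ : T => r).
Proof. by split; [exact: measurable_cst|exists `|r|]. Qed.

Lemma bounded_mfunD f g : bounded_mfun f -> bounded_mfun g ->
  bounded_mfun (fun x => f x + g x).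
Proof.
move=> [mf [M fM]] [mg [N gN]]; split; first exact: measurable_funD.
by exists (M + N) => x; rewrite (le_trans (ler_normD _ _))// lerD.
Qed.

Lemma bounded_mfunM f g : bounded_mfun f -> bounded_mfun g ->
  bounded_mfun (fun x => f x * g x).
Proof.
move=> [mf [M fM]] [mg [N gN]]; split; first exact: measurable_funM.
by exists (M * N) => x; rewrite normrM ler_pM.
Qed.

Lemma bounded_mfunN f : bounded_mfun f -> bounded_mfun (fun x => - f x).
Proof.
move=> [mf [M fM]]; split; first exact: measurableT_comp.
by exists M => x; rewrite normrN.
Qed.

Lemma bounded_mfunB f g : bounded_mfun f -> bounded_mfun g ->
  bounded_mfun (fun x => f x - g x).
Proof. by move=> bf bg; apply: bounded_mfunD => //; exact: bounded_mfunN. Qed.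

Lemma bounded_mfunX f n : bounded_mfun f -> bounded_mfun (fun x => f x ^+ n).
Proof.
move=> bf; elim: n => [|n ih]; first exact: bounded_mfun_cst.
by under eq_fun do rewrite exprS; exact: bounded_mfunM.
Qed.

Lemma bounded_mfun_sum I (r : seq I) (P : pred I) (f : I -> T -> R) :
  (forall i, bounded_mfun (f i)) ->
  bounded_mfun (fun x => \sum_(i <- r | P i) f i x).
Proof.
move=> bf; elim: r => [|i r ih].
  by under eq_fun do rewrite big_nil; exact: bounded_mfun_cst.
under eq_fun do rewrite big_cons.
by case: (P i) => //; exact: bounded_mfunD.
Qed.

Lemma bounded_mfun_norm f : bounded_mfun f -> bounded_mfun (fun x => `|f x|).
Proof.
move=> [mf [M fM]]; split; first exact: measurableT_comp.
by exists M => x; rewrite normr_id.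
Qed.

Lemma bounded_mfun_indic (A : set T) : measurable A ->
  bounded_mfun (\1_A : T -> R).
Proof.
move=> mA; split; first exact: measurable_indic.
by exists 1 => x; rewrite indicE ger0_norm// lern1 leq_b1.
Qed.

Lemma bounded_mfun_comp d' (T' : measurableType d') (X : T' -> T) f :
  measurable_fun [set: T'] X -> bounded_mfun f ->
  bounded_mfun (fun w => f (X w)).
Proof.
move=> mX [mf [M fM]]; split; first exact: measurableT_comp mf mX.
by exists M.
Qed.

Lemma bounded_mfun_integrable (mu : {measure set T -> \bar R}) (D : set T) f :
  measurable D -> (mu D < +oo)%E -> bounded_mfun f ->
  mu.-integrable D (EFin \o f).
Proof.
move=> mD Doo [mf [M fM]]; apply: measurable_bounded_integrable => //.
  exact: measurable_funTS.
exists M; split; first exact: num_real.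
by move=> y My x _ /=; rewrite (le_trans (fM x))// ltW.
Qed.

End bounded_mfun.

(** * The Stein equation of the normal distribution *)

(** Both measures agree on half-open intervals, which determine Lebesgue measure. This is the change
    of variable behind the Gaussian tail bound. *)
Lemma lebesgue_measure_translation (R : realType) (r : R) (A : set R) :
  measurable A ->
  pushforward (@lebesgue_measure R)
    ((fun t => t + r) : _ -> measurableTypeR R) A = lebesgue_measure A.
Proof.
have mT : measurable_fun [set: R] ((fun t => t + r) : _ -> measurableTypeR R).
  exact: measurable_funD.
move=> mA; apply/esym/lebesgue_measure_unique => //= _ [[a b]] _ <-.
rewrite /pushforward (_ : _ @^-1` _ = `]a - r, b - r]%classic); last first.
  by apply/seteqP; split => x /=; rewrite !in_itv/= ltrBlDr lerBrDr.
rewrite !lebesgue_measure_itv/= !lte_fin ltrD2r.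
by case: ifP => // _; rewrite -EFinB; congr EFin; ring.
Qed.

Section normal_tail.
Context {R : realType} (s : R).
Hypothesis s0 : s != 0.
Let mu := @lebesgue_measure R.
Let p := normal_pdf 0 s.

Lemma normal_pdf_gt0 x : 0 < p x.
Proof. by rewrite /p normal_pdfE// mulr_gt0 ?expR_gt0// normal_peak_gt0. Qed.

Lemma is_derive_normal_pdf (x : R) : is_derive x (1 : R) p (- (x / s ^+ 2) * p x).
Proof.
rewrite /p normal_pdfE//.
rewrite /normal_fun; apply: is_derive_eq; rewrite ?scaler0/=.
by rewrite /GRing.scale/=; field.
Qed.

(* After the shift [t = x + u], the sign condition [0 <= x * u] gives
   [p (x + u) <= p x * p u / p 0]. *)
Lemma normal_pdf_tail (x : R) (D : set (measurableTypeR R)) : measurable D ->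
  (forall t, D t -> 0 <= x * (t - x)) ->
  (\int[mu]_(t in D) (p t)%:E <= (p x / p 0)%:E)%E.
Proof.
move=> mD Dx.
have mp : measurable_fun setT (EFin \o p).
  by apply/measurable_EFinP; exact: measurable_normal_pdf.
have p0 t : (0 <= (p t)%:E)%E by rewrite lee_fin normal_pdf_ge0.
pose sh : R -> measurableTypeR R := fun t => t + x.
have mT : measurable_fun [set: R] sh by exact: measurable_funD.
have -> : (\int[mu]_(t in D) (p t)%:E =
   \int[pushforward mu sh]_(t in D) (p t)%:E)%E.
  by apply: eq_measure_integral => //= A mA _; rewrite lebesgue_measure_translation.
rewrite ge0_integral_pushforward//=; last exact: measurable_funTS.
have mD' : measurable (sh @^-1` D).
  by rewrite -[X in measurable X]setTI; exact: mT.
apply: (@le_trans _ _ (\int[mu]_(t in sh @^-1` D)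
   ((p x / p 0)%:E * (p t)%:E))%E).
  apply: ge0_le_integral => //=.
  - apply: measurable_funTS; apply: measurableT_comp => //=.
    by apply: measurableT_comp => //; exact: measurable_normal_pdf.
  - by apply: measurable_funTS; exact: measurable_funeM.
  - move=> t; rewrite /sh/= => /Dx; rewrite addrK => xt; rewrite lee_fin.
    rewrite /p normal_pdfE// /normal_fun !subr0.
    have := normal_peak_gt0 s0; set k := normal_peak s => k0.
    rewrite expr0n/= oppr0 mul0r expR0 mulr1.
    rewrite [leRHS](_ : _ = k * (expR (- x ^+ 2 / (s ^+ 2 *+ 2)) *
        expR (- t ^+ 2 / (s ^+ 2 *+ 2)))); last by field; exact: lt0r_neq0.
    rewrite -expRD ler_pM2l// ler_expR -mulrDl ler_pM2r; first lra.
    by rewrite invr_gt0 pmulrn_lgt0// exprn_even_gt0.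
rewrite ge0_integralZl//=; [|exact: measurable_funTS|]; last first.
  by rewrite lee_fin divr_ge0// normal_pdf_ge0.
rewrite -[leRHS]mule1 lee_wpmul2l//.
  by rewrite lee_fin divr_ge0// normal_pdf_ge0.
rewrite -[leRHS](integral_normal_pdf 0 s).
exact: ge0_subset_integral.
Qed.

End normal_tail.

Lemma lipschitz_continuous (R : realType) (f : R -> R) (K : R) :
  (forall x y, `|f x - f y| <= K * `|x - y|) -> continuous f.
Proof.
move=> fK x; apply/cvgrPdist_lt => /= e e0.
have K0 : 0 <= K by have := fK 1 0; rewrite subr0 normr1 mulr1; exact: le_trans.
(* [K] may vanish, so the division is by [K + 1]. *)
have K1 : 0 < K + 1 by rewrite ltr_wpDl.
have d0 : 0 < (K + 1)^-1 * e by apply: mulr_gt0 => //; rewrite invr_gt0.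
have xx : y @[y --> x] --> x by exact: cvg_id.
near=> y; rewrite (le_lt_trans (fK _ _))//.
rewrite (@le_lt_trans _ _ ((K + 1) * `|x - y|))//.
  by rewrite ler_wpM2r// lerDl.
rewrite -ltr_pdivlMl//; near: y; exact: (cvgr_dist_lt xx d0).
Unshelve. all: by end_near. Qed.

Section stein.
Context {R : realType} (s : R) (h : R -> R) (L : R).
Hypothesis s0 : s != 0.
Hypothesis h01 : forall x, 0 <= h x <= 1.
Hypothesis h_lip : forall x y, `|h x - h y| <= L * `|x - y|.
Let mu := @lebesgue_measure R.
Let p := normal_pdf 0 s.
Let c := \int[mu]_x (h x * p x).
Let g x := (h x - c) * p x.
Let A x := \int[mu]_(t in `]-oo, x]) g t.

(** Since [s^2 p' = - x p], the Stein equation multiplied by [p] reads [(s^2 p f)' = (h - c) p].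
    This is the solution whose product with [p] vanishes at -oo; any other differs from it by a
    multiple of [1 / p], which is unbounded. *)
Definition stein_sol x := A x / (s ^+ 2 * p x).
(** The derivative as dictated by the Stein equation, which therefore holds by construction; that it
    is the derivative is a separate lemma. Its regularity can thus be read off from [h] and
    [stein_sol]. *)
Definition stein_sol' x := (h x - c + x * stein_sol x) / s ^+ 2.

Let L0 : 0 <= L.
Proof. by have := h_lip 1 0; rewrite subr0 normr1 mulr1; exact: le_trans. Qed.

Let h_cont : continuous h. Proof. exact: lipschitz_continuous h_lip. Qed.

Let mh : measurable_fun [set: R] h.
Proof. exact: continuous_measurable_fun. Qed.

Let intp : mu.-integrable [set: R] (EFin \o p).
Proof. exact: integrable_normal_pdf. Qed.

Let p0 x : 0 < p x. Proof. exact: normal_pdf_gt0. Qed.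

Let mp : measurable_fun [set: R] p.
Proof. exact: measurable_normal_pdf. Qed.

Let inthp : mu.-integrable [set: R] (EFin \o (fun x => h x * p x)).
Proof.
apply: le_integrable intp => //=.
  by apply/measurable_EFinP; exact: measurable_funM.
move=> x _ /=; rewrite lee_fin normrM (ger0_norm (ltW (p0 x))).
have /andP[hx0 hx1] := h01 x.
by rewrite ler_piMl// ?(ltW (p0 x))// ger0_norm.
Qed.

Let c01 : 0 <= c <= 1.
Proof.
rewrite /c; apply/andP; split.
  apply: Rintegral_ge0 => x _.
  by rewrite mulr_ge0 ?(ltW (p0 x))//; have /andP[] := h01 x.
have <- : \int[mu]_x p x = 1 by rewrite /Rintegral integral_normal_pdf.
apply: le_Rintegral => // x _.
by rewrite ler_piMl ?(ltW (p0 x))//; have /andP[] := h01 x.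
Qed.

Let hc1 x : `|h x - c| <= 1.
Proof.
have /andP[? ?] := h01 x; have /andP[? ?] := c01.
by rewrite ler_norml; lra.
Qed.

Let intg : mu.-integrable [set: R] (EFin \o g).
Proof.
apply: le_integrable intp => //=.
  by apply/measurable_EFinP/measurable_funM => //; exact: measurable_funB.
move=> x _ /=; rewrite lee_fin normrM (ger0_norm (ltW (p0 x))).
by rewrite ler_piMl// ?(ltW (p0 x)).
Qed.

(** [c] is the mean of [h] under the normal law. Hence the integrals of [g] over the two tails at
    [x] are opposite, and [A x] can be estimated from either of them. *)
Let int_g0 : \int[mu]_x g x = 0.
Proof.
have -> : \int[mu]_x g x = \int[mu]_x (h x * p x - c * p x).
  by apply: eq_Rintegral => x _; rewrite /g mulrBl.
rewrite RintegralB//; last exact: (integrableZl measurableT c intp).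
rewrite RintegralZl// [X in _ - _ * X](_ : _ = 1) ?mulr1 ?subrr//.
by rewrite /Rintegral integral_normal_pdf.
Qed.

Let g_tail x (D : set (measurableTypeR R)) : measurable D ->
  (forall t, D t -> 0 <= x * (t - x)) -> `|\int[mu]_(t in D) g t| <= p x / p 0.
Proof.
move=> mD Dx.
have iD f : mu.-integrable [set: R] (EFin \o f) -> mu.-integrable D (EFin \o f).
  by apply: integrableS.
apply: (le_trans (le_normr_Rintegral mD (iD _ intg))).
apply: (@le_trans _ _ (\int[mu]_(t in D) p t)).
  apply: le_Rintegral => //; [|exact: iD|].
    by apply/iD/integrable_norm.
  by move=> t _; rewrite normrM (ger0_norm (ltW (p0 t))) ler_piMl// ?(ltW (p0 t)).
rewrite -lee_fin (le_trans _ (normal_pdf_tail s0 mD Dx))// /Rintegral fineK//.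
exact: integrable_fin_num (iD _ intp).
Qed.

(** The lower tail serves for [x <= 0] and the upper tail for [x > 0]: these are the sides on which
    [x (t - x) >= 0], as the Gaussian tail bound requires. *)
Let A_bound x : `|A x| <= p x / p 0.
Proof.
have [x0|x0] := leP x 0.
  apply: g_tail => // t /=; rewrite in_itv/= => tx.
  by rewrite mulr_le0// subr_le0.
have := @Rintegral_itvB _ g -oo%O +oo%O x; rewrite set_itvNyy => /(_ intg).
rewrite int_g0 sub0r => /(_ isT isT) /eqP; rewrite eqr_oppLR => /eqP AE.
rewrite /A AE normrN; apply: g_tail => // t /=; rewrite in_itv/= andbT => tx.
by rewrite mulr_ge0 ?ltW// subr_gt0.
Qed.

Let g_cont : continuous g.
Proof.
move=> x; apply: cvgM; last exact: continuous_normal_pdf.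
by apply: cvgB; [exact: h_cont|exact: cvg_cst].
Qed.

Let A_derive x : is_derive x (1 : R) A (g x).
Proof.
have [] := @continuous_FTC1 _ g -oo%O x (x + 1).
- by rewrite ltrDl.
- by apply: integrableS intg.
- by rewrite ltNyr.
- exact: g_cont.
by rewrite derive1E => /derivableP + <-.
Qed.

Lemma is_derive_stein_sol (x : R) :
  is_derive x (1 : R) stein_sol (stein_sol' x).
Proof.
have dp : is_derive x (1 : R) (fun y => s ^+ 2 * p y)
    (s ^+ 2 * (- (x / s ^+ 2) * p x)).
  have := is_derive_normal_pdf s0 x; rewrite -/p => ?.
  exact: (is_deriveZ (s ^+ 2)).
have sp0 : s ^+ 2 * p x != 0 by rewrite mulf_neq0 ?expf_neq0// gt_eqF.
have dV := @is_deriveV R (fun y => s ^+ 2 * p y) _ _ _ sp0 dp.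
have dM := is_deriveM (A_derive x) dV.
apply: is_derive_eq dM _.
rewrite /stein_sol' /stein_sol /g /GRing.scale/=.
by field; rewrite s0 gt_eqF.
Qed.

Lemma stein_solE x : s ^+ 2 * stein_sol' x - x * stein_sol x = h x - c.
Proof. by rewrite /stein_sol'; field. Qed.

(** The bound on [A x] is proportional to [p x], which the denominator [s^2 p x] cancels. *)
Lemma stein_sol_bound : exists M, forall x, `|stein_sol x| <= M.
Proof.
exists (s ^+ 2 * p 0)^-1 => x.
have sp : 0 < s ^+ 2 by rewrite exprn_even_gt0.
rewrite /stein_sol normrM (ger0_norm (_ : 0 <= (s ^+ 2 * p x)^-1)); last first.
  by rewrite invr_ge0 mulr_ge0 ?ltW.
have spx : 0 < s ^+ 2 * p x by apply: mulr_gt0.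
rewrite ler_pdivrMr//; apply: le_trans (A_bound x) _.
by rewrite invfM mulrACA mulVf ?mul1r ?gt_eqF// mulrC.
Qed.

Lemma stein_sol_continuous : continuous stein_sol.
Proof.
move=> x; apply/differentiable_continuous/derivable1_diffP.
by have [] := is_derive_stein_sol x.
Qed.

Lemma stein_sol'_continuous : continuous stein_sol'.
Proof.
move=> x; apply: cvgM; last exact: cvg_cst.
apply: cvgD; last by apply: cvgM; [exact: cvg_id|exact: stein_sol_continuous].
by apply: cvgB; [exact: h_cont|exact: cvg_cst].
Qed.

Lemma bounded_mfun_stein_sol d (T : measurableType d) (W : T -> R) :
  bounded_mfun W -> bounded_mfun (fun w => stein_sol (W w)).
Proof.
move=> [mW _]; have [M fM] := stein_sol_bound; split; last by exists M.
apply: measurableT_comp mW.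
by apply: continuous_measurable_fun; exact: stein_sol_continuous.
Qed.

Lemma bounded_mfun_stein_sol' d (T : measurableType d) (W : T -> R) :
  bounded_mfun W -> bounded_mfun (fun w => stein_sol' (W w)).
Proof.
move=> bW; apply: bounded_mfunM; last exact: bounded_mfun_cst.
apply: bounded_mfunD; last by apply: bounded_mfunM => //; exact: bounded_mfun_stein_sol.
apply: bounded_mfunB; last exact: bounded_mfun_cst.
split; first by apply: measurableT_comp mh _; case: bW.
by exists 1 => w; have /andP[h0 h1] := h01 (W w); rewrite ger0_norm.
Qed.

Let stein_sol_mvt u v : u < v -> exists2 z, u <= z <= v &
  stein_sol v - stein_sol u = stein_sol' z * (v - u).
Proof.
move=> uv; have [z] := @MVT _ stein_sol stein_sol' u v uv
  (fun z _ => is_derive_stein_sol z)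
  (@continuous_subspaceT _ _ _ _ stein_sol_continuous).
by rewrite in_itv/= => /andP[? ?] ?; exists z => //; rewrite !ltW.
Qed.

(* The bound grows quadratically in [b]: it is integrated against variables
   whose second moments are bounded, so no uniform bound on [f''] is needed. *)
Lemma stein_sol'_lip : exists K, 0 <= K /\ forall a b, `|a - b| <= 1 ->
  `|stein_sol' a - stein_sol' b| <= K * (1 + b ^+ 2) * `|a - b|.
Proof.
have [M fM] := stein_sol_bound.
have M0 : 0 <= M := le_trans (normr_ge0 _) (fM 0).
have sp : 0 < s ^+ 2 by rewrite exprn_even_gt0.
have nsV : `|(s ^+ 2)^-1| = (s ^+ 2)^-1 by rewrite ger0_norm// invr_ge0 ltW.
have f'M x : `|stein_sol' x| <= (1 + `|x| * M) / s ^+ 2.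
  rewrite /stein_sol' normrM nsV.
  rewrite ler_pM2r ?invr_gt0// (le_trans (ler_normD _ _))// lerD//.
  by rewrite normrM ler_wpM2l.
(* [L] comes from [h a - h b], [M] from [(a - b) * stein_sol a], and the last term from
   [b * (stein_sol a - stein_sol b)], estimated by the mean value theorem at a point [z] with
   [|z| <= |b| + 1]. *)
exists ((L + M + 2 * ((1 + 2 * M) / s ^+ 2)) / s ^+ 2).
have K0 : 0 <= (1 + 2 * M) / s ^+ 2 by apply: divr_ge0; [lra|exact: ltW].
split.
  apply: divr_ge0; last exact: ltW.
  by apply: addr_ge0; [exact: addr_ge0|exact: mulr_ge0].
move=> a b ab1.
have flip : `|stein_sol a - stein_sol b| <=
    (1 + (`|b| + 1) * M) / s ^+ 2 * `|a - b|.
  have bd z : `|z| <= `|b| + 1 ->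
      `|stein_sol' z| <= (1 + (`|b| + 1) * M) / s ^+ 2.
    move=> zb; rewrite (le_trans (f'M z))// ler_pM2r ?invr_gt0//.
    by rewrite lerD2l ler_wpM2r.
  move: (ab1); rewrite ler_norml => /andP[ab1l ab1r].
  have near_b z : -1 <= z - b <= 1 -> `|z| <= `|b| + 1.
    move=> zb; rewrite -lerBlDl (le_trans (lerB_dist _ _))//.
    by rewrite ler_norml.
  have [ab|ba|->] := ltgtP a b.
  - have [z zab] := stein_sol_mvt ab.
    rewrite (distrC (stein_sol a)) => ->.
    rewrite normrM (distrC b a) ler_wpM2r// bd//.
    by apply: near_b; lra.
  - have [z zab ->] := stein_sol_mvt ba.
    rewrite normrM ler_wpM2r// bd//.
    by apply: near_b; lra.
  - by rewrite !subrr normr0 mulr0.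
have -> : stein_sol' a - stein_sol' b = ((h a - h b) +
   ((a - b) * stein_sol a + b * (stein_sol a - stein_sol b))) / s ^+ 2.
  by rewrite /stein_sol'; field.
rewrite normrM nsV.
rewrite [leRHS](_ : _ = ((L + M + 2 * ((1 + 2 * M) / s ^+ 2)) *
   (1 + b ^+ 2) * `|a - b|) / s ^+ 2); last by field.
rewrite ler_pM2r ?invr_gt0//.
rewrite (le_trans (ler_normD _ _))// (le_trans (lerD (h_lip _ _) (ler_normD _ _)))//.
rewrite (normrM (a - b)) (normrM b).
have fMa := ler_wpM2l (normr_ge0 (a - b)) (fM a).
have bflip := ler_wpM2l (normr_ge0 b) flip.
apply: (le_trans (lerD (lexx _) (lerD fMa bflip))).
rewrite -(real_normK (num_real b)).
have := normr_ge0 b; set B := `|b| => B0; set D := `|a - b|.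
rewrite [leLHS](_ : _ =
  (L + M + B * (1 + (B + 1) * M) / s ^+ 2) * D); last by field.
rewrite ler_wpM2r// ?normr_ge0//.
have B2 : 0 <= B ^+ 2 by exact: sqr_ge0.
have LM : L + M <= (L + M) * (1 + B ^+ 2) by rewrite ler_peMr ?addr_ge0// lerDl.
(* Both [B] and [B (B + 1)] are absorbed into multiples of [1 + B^2] by means of [B <= 1 + B^2]. *)
have BM : B * (1 + (B + 1) * M) / s ^+ 2 <=
    2 * ((1 + 2 * M) / s ^+ 2) * (1 + B ^+ 2).
  rewrite [leRHS](_ : _ = 2 * (1 + 2 * M) * (1 + B ^+ 2) / s ^+ 2); last by field.
  rewrite ler_pM2r ?invr_gt0//.
  have B1 : B <= 1 + B ^+ 2 by have := sqr_ge0 (B - 1); rewrite sqrrB; nra.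
  have := ler_wpM2r M0 B1; have := mulr_ge0 M0 B2; nra.
by rewrite [leRHS]mulrDl lerD.
Qed.

(** By the mean value theorem the remainder is [(f' z - f' b) (a - b)] with [z] between [a] and [b],
    so the local Lipschitz constant of [f'] serves unchanged. A second derivative would require more
    of [h] than the Lipschitz property. *)
Lemma stein_sol_taylor : exists K, 0 <= K /\ forall a b, `|a - b| <= 1 ->
  `|stein_sol a - stein_sol b - (a - b) * stein_sol' b| <=
    K * (1 + b ^+ 2) * (a - b) ^+ 2.
Proof.
have [K [K0 f'K]] := stein_sol'_lip.
exists K; split => // a b ab1.
have [z zab ->] : exists2 z, `|z - b| <= `|a - b| &
    stein_sol a - stein_sol b = stein_sol' z * (a - b).
  have [ab|ba|->] := ltgtP a b.
  - have [z zab E] := stein_sol_mvt ab; exists z; last first.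
      by rewrite -opprB E -mulrN opprB.
    by rewrite !ler0_norm; lra.
  - have [z zab E] := stein_sol_mvt ba; exists z => //.
    by rewrite !ger0_norm; lra.
  - by exists b; rewrite // !subrr mulr0.
rewrite (mulrC (a - b)) -mulrBl normrM.
rewrite -(real_normK (num_real (a - b))) expr2 mulrA ler_wpM2r//.
rewrite (le_trans (f'K _ _ (le_trans zab ab1)))//.
by rewrite ler_wpM2l// mulr_ge0// addr_ge0// sqr_ge0.
Qed.

End stein.

(** * Independence and the central limit theorem *)

(** Independence says that the law of the pair [(U, V)] agrees with the product of the laws on
    rectangles, hence everywhere; Fubini's theorem then factors the integral. *)
Lemma expectation_indepM (R : realType) d (Omega : measurableType d)
    (Pr : probability Omega R) d1 d2 (T1 : measurableType d1)
    (T2 : measurableType d2) (U : {mfun Omega >-> T1}) (V : {mfun Omega >-> T2})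
    (f : T1 -> R) (g : T2 -> R) :
  (forall A B, measurable A -> measurable B ->
    Pr (U @^-1` A `&` V @^-1` B) = (Pr (U @^-1` A) * Pr (V @^-1` B))%E) ->
  bounded_mfun f -> bounded_mfun g ->
  \int[Pr]_w (f (U w) * g (V w)) = (\int[Pr]_w f (U w)) * (\int[Pr]_w g (V w)).
Proof.
move=> UV bf bg.
have mUV : measurable_fun [set: Omega] (fun w => (U w, V w)).
  exact: measurable_fun_pair.
pose W : {mfun Omega >-> (T1 * T2)%type} :=
  HB.pack (fun w => (U w, V w)) (isMeasurableFun.Build _ _ _ _ _ mUV).
pose k (z : T1 * T2) := f z.1 * g z.2.
have bk : bounded_mfun k.
  by apply: bounded_mfunM; apply: bounded_mfun_comp.
have W_prod A : measurable A ->
    (distribution Pr U \x distribution Pr V)%E A = distribution Pr W A.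
  by move=> mA; apply: product_measure_unique => // B C mB mC; exact: UV.
have Woo : ((distribution Pr U \x distribution Pr V)%E setT < +oo)%E.
  by rewrite probability_setT ltry.
have prob_int d' (T' : measurableType d') (Q : probability T' R) (r : T' -> R) :
    bounded_mfun r -> Q.-integrable [set: T'] (EFin \o r).
  move=> br; apply: bounded_mfun_integrable => //.
  by rewrite -ge0_fin_numE ?fin_num_measure.
have distE d' (T' : measurableType d') (Y : {mfun Omega >-> T'}) (r : T' -> R) :
    bounded_mfun r ->
    (\int[Pr]_w (r (Y w))%:E = \int[distribution Pr Y]_y (r y)%:E)%E.
  move=> br; rewrite integral_distribution//.
    by apply/measurable_EFinP; case: br.
  apply: (prob_int _ _ Pr (fun w => r (Y w))).
  by apply: bounded_mfun_comp br.
rewrite {1}/Rintegral (distE _ _ W k bk).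
have -> : (\int[distribution Pr W]_y (k y)%:E =
    \int[distribution Pr U \x distribution Pr V]_y (k y)%:E)%E.
  by apply: eq_measure_integral => A mA _; exact/esym/W_prod.
rewrite -integral12_prod_meas1/=; last first.
  exact: (bounded_mfun_integrable _ Woo bk).
transitivity (fine (\int[distribution Pr U]_x
    ((f x)%:E * (\int[Pr]_w g (V w))%:E))%E).
  congr fine; apply: eq_integral => x _; rewrite /fubini_F.
  under eq_integral do rewrite /k/= EFinM.
  rewrite integralZl//; last exact: prob_int.
  rewrite -(distE _ _ V g bg) /Rintegral fineK//.
  by apply: integrable_fin_num => //; apply: prob_int; exact: bounded_mfun_comp bg.
rewrite integralZr//; last exact: prob_int.
rewrite fineM//; last by apply: integrable_fin_num => //; exact: prob_int.
by rewrite -(distE _ _ U f bf).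
Qed.

Section independent_sums.
Context (R : realType) (disp disp' : measure_display)
  (Omega : measurableType disp) (T : measurableType disp')
  (Pr : probability Omega R) (X : nat -> {RV Pr >-> T}).
Hypothesis Xind : mutually_independent X.

(** A pi-system that generates the sigma-algebra of the [X j] with [j] in [r]. *)
Let rectangles (r : seq nat) : set (set Omega) :=
  [set E | exists2 A : nat -> set T, (forall j, measurable (A j)) &
     E = \bigcap_(j in [set` r]) X j @^-1` A j].

Let mX i A : measurable A -> measurable (X i @^-1` A).
Proof. by move=> mA; rewrite -[X in measurable X]setTI; exact: measurable_funP. Qed.

Let rectangles_measurable r : rectangles r `<=` measurable.
Proof.
by move=> _ [A mA ->]; apply: fin_bigcap_measurable => // j _; exact: mX.
Qed.

(** For fixed [A], both sides are finite measures in [E]. They agree on the pi-system of rectangles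
    by mutual independence, hence on the generated sigma-algebra. *)
Let rectangles_indep (r : seq nat) i (A : set T) E : i \notin r ->
  measurable A -> <<s (rectangles r) >> E ->
  Pr (X i @^-1` A `&` E) = (Pr (X i @^-1` A) * Pr E)%E.
Proof.
move=> ir mA rE.
have PA : (0 <= fine (Pr (X i @^-1` A))) by rewrite fine_ge0.
pose m1 := mrestr Pr (mX i mA).
pose m2 := mscale (NngNum PA) Pr.
have : m1 E = m2 E.
  apply: (g_sigma_algebra_measure_unique (rectangles r)
    (@rectangles_measurable r) (fun=> setT)) rE => //.
  - move=> _; exists (fun=> setT) => //.
    by apply/esym; rewrite -subTset => w _ j _.
  - by rewrite bigcup_const//; exists 0%N.
  - move=> _ _ [B mB ->] [C mC ->]; exists (fun j => B j `&` C j).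
      by move=> j; exact: measurableI.
    by rewrite -bigcapI; apply: eq_bigcapr => j _; rewrite preimage_setI.
  - move=> _ [B mB ->].
    (* Mutual independence speaks of finite sets of indices, whereas [r] is a list. The family [C]
       puts [A] at the fresh index [i], which turns the event into a single intersection over a
       finite set. *)
    pose J := [fset j in r]%fset.
    pose C j := if j == i then A else B j.
    have mC j : measurable (C j) by rewrite /C; case: ifP.
    have iJ : i \notin J by rewrite inE.
    have CB j : j \in r -> C j = B j.
      by move=> jr; rewrite /C; case: eqVneq => // ji; move: ir; rewrite -ji jr.
    have capJ : \bigcap_(j in [set` r]) X j @^-1` B j =
        \bigcap_(j in [set` J]) X j @^-1` C j.
      apply/seteqP; split=> w Bw j /=; rewrite ?inE => jr.
        by rewrite CB//; exact: Bw.
      by rewrite -CB//; apply: Bw; rewrite /= inE.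
    rewrite /m1 /m2/= /mrestr /mscale/= fineK ?fin_num_measure//; last exact: mX.
    rewrite capJ setIC.
    have -> : X i @^-1` A `&` \bigcap_(j in [set` J]) X j @^-1` C j =
        \bigcap_(j in [set` (i |` J)%fset]) X j @^-1` C j.
      have Ci : C i = A by rewrite /C eqxx.
      apply/seteqP; split=> w.
        move=> [Aw Cw] j /=; rewrite inE in_fset1 => /orP[/eqP->|jJ].
          by rewrite Ci.
        exact: Cw.
      move=> Cw; split; first by rewrite -Ci; apply: Cw; rewrite /= fset1U1.
      by move=> j jJ; apply: Cw => /=; rewrite inE jJ orbT.
    rewrite !Xind// big_fsetU1//=.
    by rewrite /C eqxx.
  - by move=> _; rewrite /m1/= /mrestr -ge0_fin_numE// fin_num_measure// setTI; exact: mX.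
rewrite /m1 /m2/= /mrestr /mscale/= fineK ?fin_num_measure//; last exact: mX.
by rewrite setIC.
Qed.

(** The sum is measurable for the sigma-algebra generated by the rectangles over [r], each [X j]
    being so through rectangles that constrain a single coordinate. *)
Lemma mutually_independent_sum (phi : T -> R) (r : seq nat) i (A : set T)
    (B : set R) : measurable_fun [set: T] phi -> i \notin r ->
  measurable A -> measurable B ->
  Pr (X i @^-1` A `&` (fun w => \sum_(j <- r) phi (X j w))%R @^-1` B) =
  (Pr (X i @^-1` A) * Pr ((fun w => \sum_(j <- r) phi (X j w))%R @^-1` B))%E.
Proof.
move=> mphi ir mA mB; apply: (@rectangles_indep r) => //.
pose O := g_sigma_algebraType (rectangles r).
have mXO j : j \in r -> measurable_fun [set: O] (X j : O -> T).
  move=> jr _ C mC; rewrite setTI; apply: sub_sigma_algebra.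
  exists (fun k => if k == j then C else setT).
    by move=> k; case: ifP.
  apply/seteqP; split=> w.
    by move=> Cw k _ /=; case: eqVneq => // ->.
  by move=> /(_ j jr) /=; rewrite eqxx.
have mS (q : seq nat) : {subset q <= r} ->
    measurable_fun [set: O] (fun w : O => \sum_(j <- q) phi (X j w)).
  elim: q => [_|j q ih jqr].
    by under eq_fun do rewrite big_nil; exact: measurable_cst.
  under eq_fun do rewrite big_cons.
  apply: measurable_funD.
    by apply: measurableT_comp => //; apply: mXO; apply: jqr; rewrite inE eqxx.
  by apply: ih => k kq; apply: jqr; rewrite inE kq orbT.
have := mS r (fun _ => id) measurableT B mB.
by rewrite setTI.
Qed.

End independent_sums.

(** * Expectations of bounded variables *)

Section expectation.
Context {R : realType} {d : measure_display} {T : measurableType d}.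
Variable P : probability T R.
Implicit Types f g : T -> R.

Lemma bounded_mfun_probability f : bounded_mfun f ->
  P.-integrable [set: T] (EFin \o f).
Proof.
move=> bf; apply: bounded_mfun_integrable => //.
by rewrite -ge0_fin_numE ?fin_num_measure.
Qed.

Lemma expectB f g : bounded_mfun f -> bounded_mfun g ->
  \int[P]_w (f w - g w) = \int[P]_w f w - \int[P]_w g w.
Proof. by move=> bf bg; apply: RintegralB => //; exact: bounded_mfun_probability. Qed.

Lemma expectD f g : bounded_mfun f -> bounded_mfun g ->
  \int[P]_w (f w + g w) = \int[P]_w f w + \int[P]_w g w.
Proof. by move=> bf bg; apply: RintegralD => //; exact: bounded_mfun_probability. Qed.

Lemma expectZ (r : R) f : bounded_mfun f ->
  \int[P]_w (r * f w) = r * \int[P]_w f w.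
Proof. by move=> bf; apply: RintegralZl => //; exact: bounded_mfun_probability. Qed.

Lemma expect_cst (r : R) : \int[P]_w r = r.
Proof. by rewrite Rintegral_cst//= probability_setT/= mulr1. Qed.

Lemma expect_sum I (r : seq I) (Q : pred I) (F : I -> T -> R) :
  (forall i, bounded_mfun (F i)) ->
  \int[P]_w (\sum_(i <- r | Q i) F i w) = \sum_(i <- r | Q i) \int[P]_w F i w.
Proof.
move=> bF; elim: r => [|i r ih].
  by rewrite big_nil; under eq_Rintegral do rewrite big_nil; exact: expect_cst.
rewrite big_cons; under eq_Rintegral do rewrite big_cons.
by case: (Q i) => //; rewrite expectD// ?ih//; exact: bounded_mfun_sum.
Qed.

Lemma expect_le f g : bounded_mfun f -> bounded_mfun g ->
  (forall w, f w <= g w) -> \int[P]_w f w <= \int[P]_w g w.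
Proof.
by move=> bf bg fg; apply: le_Rintegral => //; exact: bounded_mfun_probability.
Qed.

Lemma expect_norm f : bounded_mfun f ->
  `|\int[P]_w f w| <= \int[P]_w `|f w|.
Proof. by move=> bf; apply: le_normr_Rintegral => //; exact: bounded_mfun_probability. Qed.

Lemma expect_indic (A : set T) : measurable A ->
  \int[P]_w \1_A w = fine (P A).
Proof. by move=> mA; rewrite /Rintegral integral_indic// setIT. Qed.

End expectation.

(** * Moments of sums of i.i.d. variables *)

Section iid.
Context (R : realType) (disp disp' : measure_display)
  (Omega : measurableType disp) (T : measurableType disp')
  (Pr : probability Omega R) (P : probability T R) (X : nat -> {RV Pr >-> T}).
Hypothesis Xiid : iid P X.

Lemma expect_law i (f : T -> R) : bounded_mfun f ->
  \int[Pr]_w f (X i w) = \int[P]_y f y.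
Proof.
move=> bf; rewrite /Rintegral; congr fine.
transitivity (\int[distribution Pr (X i)]_y (f y)%:E)%E; last first.
  by apply: eq_measure_integral => A mA _; exact: Xiid.1.
rewrite integral_distribution//.
  by apply/measurable_EFinP; case: bf.
by apply: (@bounded_mfun_probability _ _ _ Pr (fun w => f (X i w))); exact: bounded_mfun_comp bf.
Qed.

Lemma bounded_mfun_iid_sum (r : seq nat) (phi : T -> R) : bounded_mfun phi ->
  bounded_mfun (fun w => \sum_(j <- r) phi (X j w)).
Proof.
move=> bphi; apply: bounded_mfun_sum => i; exact: bounded_mfun_comp bphi.
Qed.

(** Boundedness is asked of [g] along the sum, so that [g] may be the identity, as in the cross
    terms of a second moment, or the derivative of the Stein solution. Cutting [g] off outside [D]
    gives a bounded function on the line that agrees with [g] on all values of the sum. *)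
Lemma expect_indep_sum (r : seq nat) i (phi psi : T -> R) (g : R -> R) :
  bounded_mfun phi -> bounded_mfun psi -> i \notin r ->
  measurable_fun [set: R] g ->
  bounded_mfun (fun w => g (\sum_(j <- r) phi (X j w))) ->
  \int[Pr]_w (psi (X i w) * g (\sum_(j <- r) phi (X j w))) =
  (\int[P]_y psi y) * \int[Pr]_w g (\sum_(j <- r) phi (X j w)).
Proof.
move=> bphi bpsi ir mg [mgV [M gM]].
have [mV _] := bounded_mfun_iid_sum r bphi.
set V := fun w => _ in mV.
pose V' : {mfun Omega >-> R} := HB.pack V (isMeasurableFun.Build _ _ _ _ _ mV).
pose D := [set y | `|g y| <= M].
have mD : measurable D.
  have := measurableT_comp (@normr_measurable R _) mg.
  move=> /(_ measurableT `]-oo, M]%classic (measurable_itv _)).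
  by rewrite setTI (_ : _ @^-1` _ = D)//; apply/seteqP; split => y /=; rewrite in_itv.
pose g' y := g y * \1_D y.
have bg' : bounded_mfun g'.
  split; first by apply: measurable_funM => //; exact: measurable_indic.
  exists M => y; rewrite /g' indicE; have [|] := boolP (y \in D).
    by rewrite inE mulr1.
  by rewrite mulr0 normr0 (le_trans _ (gM point)).
have gg' w : g (V w) = g' (V' w).
  by rewrite /g' indicE mem_set ?mulr1//; exact: gM.
under eq_Rintegral do rewrite (gg' _).
under [X in _ = _ * X]eq_Rintegral do rewrite (gg' _).
rewrite -(expect_law i bpsi); apply: expectation_indepM => // A B mA mB.
by apply: (mutually_independent_sum Xiid.2) => //; case: bphi.
Qed.

Lemma expect_sum_sqr (r : seq nat) (phi : T -> R) :
  bounded_mfun phi -> \int[P]_y phi y = 0 -> uniq r ->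
  \int[Pr]_w ((\sum_(j <- r) phi (X j w)) ^+ 2) =
  (size r)%:R * \int[P]_y (phi y ^+ 2).
Proof.
move=> bphi phi0; elim: r => [_|i r ih /= /andP[ir ur]].
  under eq_Rintegral do rewrite big_nil expr0n/=.
  by rewrite expect_cst mul0r.
have bV := bounded_mfun_iid_sum r bphi.
have bX j : bounded_mfun (fun w => phi (X j w)) by exact: bounded_mfun_comp bphi.
under eq_Rintegral do rewrite big_cons sqrrD -mulr_natl.
rewrite expectD//; last first.
- exact: bounded_mfunX.
- apply: bounded_mfunD; first exact: bounded_mfunX.
  by apply: bounded_mfunM; [exact: bounded_mfun_cst|exact: bounded_mfunM].
rewrite expectD//; last first.
- by apply: bounded_mfunM; [exact: bounded_mfun_cst|exact: bounded_mfunM].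
- exact: bounded_mfunX.
rewrite expectZ; last exact: bounded_mfunM.
(* The cross term vanishes because [phi] is centered. *)
rewrite (@expect_indep_sum r i phi phi id)// phi0 mul0r mulr0 addr0 ih//.
rewrite (expect_law i (bounded_mfunX 2 bphi)).
by rewrite -(natr1 (size r)); ring.
Qed.

End iid.

(** * The central limit theorem for Lipschitz test functions *)

Section clt.
Context (R : realType) (disp disp' : measure_display)
  (Omega : measurableType disp) (T : measurableType disp')
  (Pr : probability Omega R) (P : probability T R) (X : nat -> {RV Pr >-> T}).
Hypothesis Xiid : iid P X.
Variables (phi : T -> R) (s : R).
Hypothesis bphi : bounded_mfun phi.
Hypothesis phi0 : \int[P]_y phi y = 0.
Hypothesis s0 : s != 0.
Hypothesis phi2 : \int[P]_y (phi y ^+ 2) = s ^+ 2.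
Variables (h : R -> R) (L : R).
Hypothesis h01 : forall x, 0 <= h x <= 1.
Hypothesis h_lip : forall x y, `|h x - h y| <= L * `|x - y|.

Let f := stein_sol s h.
Let f' := stein_sol' s h.
Let c := \int[lebesgue_measure]_x (h x * normal_pdf 0 s x).

Let S_ (n : nat) (w : Omega) :=
  (Num.sqrt n%:R)^-1 * \sum_(0 <= j < n) phi (X j w).

(** Each of the [n] summands of the Stein identity has to be of order n^-3/2. The condition
    [B <= sqrt n] ensures [|S - V| <= 1], the range in which the two local estimates on [f] and [f']
    hold; the factor [1 + s^2] bounds the mean of [1 + V^2]. *)
Lemma clt_term (B K K' : R) (n i : nat) :
  (forall y, `|phi y| <= B) -> 0 <= K -> 0 <= K' ->
  (forall a b, `|a - b| <= 1 ->
    `|f' a - f' b| <= K' * (1 + b ^+ 2) * `|a - b|) ->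
  (forall a b, `|a - b| <= 1 ->
    `|f a - f b - (a - b) * f' b| <= K * (1 + b ^+ 2) * (a - b) ^+ 2) ->
  (i < n)%N -> B <= Num.sqrt n%:R ->
  `|\int[Pr]_w (s ^+ 2 / n%:R * f' (S_ n w) -
      (Num.sqrt n%:R)^-1 * phi (X i w) * f (S_ n w))| <=
  (Num.sqrt n%:R)^-1 * B * (s ^+ 2 * K' + B ^+ 2 * K) * (1 + s ^+ 2) / n%:R.
Proof.
move=> phiB K0 K'0 f'lip ftay lin Bn; set a := (Num.sqrt n%:R)^-1; set S := S_ n.
have n0 : 0 < n%:R :> R by rewrite ltr0n (leq_ltn_trans _ lin).
have sn0 : 0 < Num.sqrt n%:R :> R by rewrite sqrtr_gt0.
have B0 : 0 <= B := le_trans (normr_ge0 _) (phiB point).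
have a0 : 0 < a by rewrite invr_gt0.
have a2 : a ^+ 2 = n%:R^-1 by rewrite exprVn sqr_sqrtr// ltW.
have b1 : a * B <= 1 by rewrite mulrC ler_pdivrMr// mul1r.
pose q := [seq j <- index_iota 0 n | j != i].
have iq : i \notin q by rewrite mem_filter eqxx.
pose Y w := phi (X i w).
pose V w := a * \sum_(j <- q) phi (X j w).
have SV w : S w = V w + a * Y w.
  rewrite /S /V -mulrDr; congr (a * _).
  rewrite (bigD1_seq i) ?iota_uniq ?mem_index_iota//= addrC.
  by rewrite big_filter.
have bY : bounded_mfun Y by exact: bounded_mfun_comp bphi.
have bs r : bounded_mfun (fun w => a * \sum_(j <- r) phi (X j w)).
  by apply: bounded_mfunM; [exact: bounded_mfun_cst|exact: bounded_mfun_iid_sum].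
have bV : bounded_mfun V := bs q.
have bS : bounded_mfun S := bs (index_iota 0 n).
have bfV : bounded_mfun (fun w => f (V w)) by exact: bounded_mfun_stein_sol bV.
have bfS : bounded_mfun (fun w => f (S w)) by exact: bounded_mfun_stein_sol bS.
have bf'V : bounded_mfun (fun w => f' (V w)) by exact: bounded_mfun_stein_sol' bV.
have bf'S : bounded_mfun (fun w => f' (S w)) by exact: bounded_mfun_stein_sol' bS.
have bc r := @bounded_mfun_cst R _ Omega r.
have bcT r := @bounded_mfun_cst R _ T r.
(* The total coefficient of [f' (V w)]. It is centered because [phi] has variance [s^2] and
   [a^2 = 1 / n], and this is where the second moment of [phi] is matched with that of the normal
   law. *)
pose psi y := s ^+ 2 / n%:R - a ^+ 2 * phi y ^+ 2.
have bpsi : bounded_mfun psi.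
  apply: bounded_mfunB => //; apply: bounded_mfunM => //; exact: bounded_mfunX.
pose rho w := s ^+ 2 / n%:R * (f' (S w) - f' (V w)) -
  a * Y w * (f (S w) - f (V w) - a * Y w * f' (V w)).
have baY : bounded_mfun (fun w => a * Y w) by exact: bounded_mfunM.
have brho : bounded_mfun rho.
  apply: bounded_mfunB.
    by apply: bounded_mfunM => //; exact: bounded_mfunB.
  apply: bounded_mfunM => //; apply: bounded_mfunB; first exact: bounded_mfunB.
  exact: bounded_mfunM.
have decomp w : s ^+ 2 / n%:R * f' (S w) - a * phi (X i w) * f (S w) =
   (psi (X i w) * f' (V w) - a * (Y w * f (V w))) + rho w.
  by rewrite /psi /rho /Y; ring.
have bpX : bounded_mfun (fun w => psi (X i w)) by exact: bounded_mfun_comp bpsi.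
under eq_Rintegral do rewrite decomp.
rewrite expectD//; last first.
  apply: bounded_mfunB; first exact: bounded_mfunM.
  by apply: bounded_mfunM => //; exact: bounded_mfunM.
rewrite expectB; [|exact: bounded_mfunM|by apply: bounded_mfunM => //; exact: bounded_mfunM].
rewrite expectZ; last exact: bounded_mfunM.
have ma : measurable_fun [set: R] (fun x : R => a * x) by exact: measurable_funM.
have mf : measurable_fun [set: R] (fun x => f (a * x)).
  apply: (measurableT_comp _ ma).
  apply: continuous_measurable_fun; exact: stein_sol_continuous h_lip.
have mf' : measurable_fun [set: R] (fun x => f' (a * x)).
  apply: (measurableT_comp _ ma).
  apply: continuous_measurable_fun; exact: stein_sol'_continuous h_lip.
rewrite (expect_indep_sum Xiid bphi bpsi iq mf' bf'V).
rewrite (expect_indep_sum Xiid bphi bphi iq mf bfV) phi0 mul0r mulr0 subr0.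
have -> : \int[P]_y psi y = 0.
  rewrite expectB//; last by apply: bounded_mfunM => //; exact: bounded_mfunX.
  by rewrite expect_cst expectZ ?phi2 ?a2 1?mulrC ?subrr//; exact: bounded_mfunX.
rewrite mul0r add0r (le_trans (expect_norm _ brho))//.
(* The two parts of [rho] are at most [(s^2 / n) K' (1 + V^2) (a B)] and
   [(a B) K (1 + V^2) (a B)^2]. As [(a B)^2 = B^2 / n], they add up to [Q (1 + V^2)]. *)
pose Q := a * B * (s ^+ 2 * K' + B ^+ 2 * K) / n%:R.
have Q0 : 0 <= Q.
  apply: divr_ge0; last exact: ltW.
  apply: mulr_ge0; first exact: (mulr_ge0 (ltW a0) B0).
  by apply: addr_ge0; apply: mulr_ge0 => //; exact: sqr_ge0.
have V2 : \int[Pr]_w (V w ^+ 2) <= s ^+ 2.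
  under eq_Rintegral do rewrite /V exprMn.
  rewrite expectZ; last by apply: bounded_mfunX; exact: bounded_mfun_iid_sum.
  rewrite (expect_sum_sqr Xiid)//; last by rewrite filter_uniq// iota_uniq.
  rewrite phi2 a2 mulrA ler_piMl ?sqr_ge0// mulrC ler_pdivrMr// mul1r ler_nat.
  by rewrite size_filter (leq_trans (count_size _ _))// size_iota subn0.
apply: (@le_trans _ _ (\int[Pr]_w (Q * (1 + V w ^+ 2)))).
  apply: expect_le; [exact: bounded_mfun_norm| |].
    by apply: bounded_mfunM => //; apply: bounded_mfunD => //; exact: bounded_mfunX.
  move=> w.
  have aYB : `|a * Y w| <= a * B.
    by rewrite normrM (gtr0_norm a0) ler_pM2l//; exact: phiB.
  have SVE : S w - V w = a * Y w by rewrite SV addrC addKr.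
  have SV1 : `|S w - V w| <= 1 by rewrite SVE (le_trans aYB).
  have := f'lip _ _ SV1; have := ftay _ _ SV1; rewrite SVE => t1 t2.
  have W0 : 0 <= 1 + V w ^+ 2 by rewrite addr_ge0// sqr_ge0.
  rewrite /rho (le_trans (ler_normB _ _))// normrM (normrM (a * Y w)).
  rewrite (ger0_norm (_ : 0 <= s ^+ 2 / n%:R)); last by rewrite divr_ge0 ?sqr_ge0// ltW.
  have -> : Q * (1 + V w ^+ 2) =
      s ^+ 2 / n%:R * (K' * (1 + V w ^+ 2) * (a * B)) +
      a * B * (K * (1 + V w ^+ 2) * (a * B) ^+ 2).
    have ab2 : (a * B) ^+ 2 = n%:R^-1 * B ^+ 2 by rewrite exprMn a2.
    by rewrite ab2 /Q; field; rewrite gt_eqF.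
  apply: lerD.
    apply: ler_wpM2l; first by rewrite divr_ge0 ?sqr_ge0// ltW.
    by apply: (le_trans t2); rewrite ler_wpM2l// mulr_ge0.
  apply: ler_pM => //; apply: (le_trans t1); rewrite ler_wpM2l// ?mulr_ge0//.
  by rewrite -(real_normK (num_real (a * Y w))) ler_pXn2r// nnegrE// mulr_ge0// ltW.
rewrite expectZ; last by apply: bounded_mfunD => //; exact: bounded_mfunX.
rewrite expectD//; last exact: bounded_mfunX.
rewrite expect_cst [leRHS](_ : _ = Q * (1 + s ^+ 2)); last by rewrite /Q; ring.
by rewrite ler_wpM2l// lerD2l.
Qed.

Lemma clt_rate : exists C, forall n, (0 < n)%N ->
  C <= Num.sqrt n%:R ->
  `|\int[Pr]_w h (S_ n w) - c| <=
  C / Num.sqrt n%:R.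
Proof.
have [B phiB] := bphi.2.
have B0 : 0 <= B := le_trans (normr_ge0 _) (phiB point).
have [K [K0 ftay]] := stein_sol_taylor s0 h01 h_lip.
have [K' [K'0 f'lip]] := stein_sol'_lip s0 h01 h_lip.
pose C := B * (s ^+ 2 * K' + B ^+ 2 * K) * (1 + s ^+ 2).
have C0 : 0 <= C.
  apply: mulr_ge0; last by rewrite addr_ge0// sqr_ge0.
  apply: mulr_ge0 => //.
  by apply: addr_ge0; apply: mulr_ge0 => //; exact: sqr_ge0.
(* A single constant serves as rate and as threshold; [B] is added so that the threshold implies the
   condition [B <= sqrt n] of [clt_term]. *)
exists (B + C) => n n0 Cn.
have Bn : B <= Num.sqrt n%:R by apply: le_trans Cn; rewrite lerDl.
set a := (Num.sqrt n%:R)^-1; set S := S_ n.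
have nR0 : 0 < n%:R :> R by rewrite ltr0n.
have a0 : 0 < a by rewrite invr_gt0 sqrtr_gt0.
have bX j : bounded_mfun (fun w => phi (X j w)) by exact: bounded_mfun_comp bphi.
have bc r := @bounded_mfun_cst R _ Omega r.
pose D i w := s ^+ 2 / n%:R * f' (S w) - a * phi (X i w) * f (S w).
have bS : bounded_mfun S.
  by apply: bounded_mfunM => //; exact: bounded_mfun_iid_sum.
have bfS : bounded_mfun (fun w => f (S w)) by exact: bounded_mfun_stein_sol bS.
have bf'S : bounded_mfun (fun w => f' (S w)) by exact: bounded_mfun_stein_sol' bS.
have bD i : bounded_mfun (D i).
  by apply: bounded_mfunB; apply: bounded_mfunM => //; exact: bounded_mfunM.
(* The Stein equation at [S w] is distributed over the sample: [s^2 f'] in equal parts, [S f]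
   according to the summands of [S]. *)
have hE w : h (S w) - c = \sum_(0 <= i < n) D i w.
  rewrite -(@stein_solE _ s h s0) sumrB sumr_const_nat subn0 -mulr_suml -mulr_sumr.
  by rewrite -mulr_natl -/f -/f'; congr (_ - _); field; rewrite gt_eqF.
have -> : \int[Pr]_w h (S w) - c = \sum_(0 <= i < n) \int[Pr]_w D i w.
  rewrite -expect_sum//.
  under [RHS]eq_Rintegral do rewrite -hE.
  rewrite expectB// ?expect_cst//.
  have -> : (fun w => h (S w)) = (fun w => \sum_(0 <= i < n) D i w + c).
    by apply/funext => w; rewrite -hE subrK.
  by apply: bounded_mfunD => //; exact: bounded_mfun_sum.
apply: (le_trans (ler_norm_sum _ _ _)).
apply: (@le_trans _ _ (\sum_(0 <= i < n) (a * C / n%:R))).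
  rewrite big_nat_cond [leRHS]big_nat_cond; apply: ler_sum => i /andP[/andP[_ lin] _].
  have := clt_term phiB K0 K'0 f'lip ftay lin Bn.
  by rewrite /C !mulrA.
rewrite sumr_const_nat subn0 -mulr_natl.
rewrite [leLHS](_ : _ = C * a); last by field; rewrite gt_eqF.
by rewrite ler_pM2r// lerDr.
Qed.

Lemma clt_lipschitz :
  \int[Pr]_w h (S_ n w)
    @[n --> \oo] --> c.
Proof.
have [C rate] := clt_rate.
have sqrtoo : (Num.sqrt n%:R : R) @[n --> \oo] --> +oo.
  apply/cvgryPge => M; near=> n.
  rewrite (le_trans (ler_norm M))// -(sqrtr_sqr M) ler_wsqrtr//.
  by near: n; exact: nbhs_infty_ger.
have inv0 : (Num.sqrt n%:R : R)^-1 @[n --> \oo] --> 0.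
  apply/gtr0_cvgV0 => //; near=> n; rewrite sqrtr_gt0 ltr0n.
  by near: n; exact: nbhs_infty_gt.
have Ce0 : C / Num.sqrt n%:R @[n --> \oo] --> 0.
  by rewrite -[X in _ --> X](mulr0 C); apply: cvgMr.
apply/cvgrPdist_le => /= e e0; near=> n.
rewrite distrC (le_trans (rate n _ _))//.
- by near: n; exact: nbhs_infty_gt.
- by near: n; move/cvgryPge: sqrtoo => /(_ C).
- apply: (le_trans (ler_norm _)); rewrite -[X in `|X|]subr0 distrC.
  by near: n; move/cvgrPdist_le : Ce0 => /(_ e e0).
Unshelve. all: by end_near. Qed.

End clt.

(** * The distance to measure as a maximum *)

Section layer_cake.
Context {R : realType} {d : measure_display} {T : measurableType d}.
Notation leb := (@lebesgue_measure R).

(** The indicator of [Y y <= t] is written as that of [0 <= t - Y y], a composition in which joint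
    measurability in [(y, t)] is immediate. *)
Let measurable_step (q : R) (g Y : T -> R) :
  measurable_fun [set: T] g -> measurable_fun [set: T] Y ->
  measurable_fun [set: T * measurableTypeR R] (fun z =>
    (g z.1 * \1_`[0, +oo[ (z.2 - Y z.1) * \1_`[0, q] z.2)%:E).
Proof.
move=> mg mY; apply/measurable_EFinP.
have mi (a b : itv_bound R) : measurable_fun [set: R] (\1_[set` Interval a b] : R -> R).
  exact: measurable_indic.
apply: measurable_funM; last exact: (measurableT_comp (mi _ _)).
apply: measurable_funM; first exact: (measurableT_comp mg).
apply: (measurableT_comp (mi _ _)); apply: measurable_funB => //.
exact: (measurableT_comp mY).
Qed.

Lemma integral_step_function (q y : R) : 0 <= y ->
  (\int[leb]_(t in `[0%R, q]) (\1_`[y, +oo[ t)%:E = (Num.max 0 (q - y))%R%:E)%E.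
Proof.
move=> y0; rewrite integral_indic//= (_ : _ `&` _ = `[y, q]%classic); last first.
  apply/seteqP; split => t /=; rewrite !in_itv/= ?andbT.
    by move=> [yt /andP[_ ->]]; rewrite yt.
  by move=> /andP[yt ->]; rewrite yt (le_trans y0 yt).
rewrite lebesgue_measure_itv/= lte_fin; case: ltP => yq.
  by rewrite -EFinB max_r// subr_ge0 ltW.
by rewrite max_l// subr_le0.
Qed.

(** For [Y >= 0], [max(0, q - Y)] is the integral over [0, q] of the indicator of [Y <= t]; then
    Tonelli's theorem applies. The weight [g] is what yields second moments later, and
    sigma-finiteness lets [P] be Lebesgue measure, as needed for the quantile function. *)
Lemma layer_cake (P : {sigma_finite_measure set T -> \bar R}) (q : R)
    (g Y : T -> R) :
  measurable_fun [set: T] g -> (forall y, 0 <= g y) ->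
  measurable_fun [set: T] Y -> (forall y, 0 <= Y y) ->
  (\int[P]_y (g y * Num.max 0 (q - Y y))%R%:E =
   \int[leb]_(t in `[0%R, q]) \int[P]_y (g y * \1_[set y | Y y <= t] y)%R%:E)%E.
Proof.
move=> mg g0 mY Y0.
have := measurable_step q mg mY; set f := (fun z => _) => mf.
have f0 z : (0 <= f z)%E by rewrite lee_fin !mulr_ge0.
have := @fubini_tonelli _ _ _ _ _ P leb f mf f0.
rewrite [X in X = _](_ : _ = \int[P]_y (g y * Num.max 0 (q - Y y))%R%:E)%E; last first.
  apply: eq_integral => y _; rewrite /f/=.
  under eq_integral do rewrite -mulrA mulrC.
  transitivity (\int[leb]_(t in `[0%R, q]) ((\1_`[Y y, +oo[ t)%:E * (g y)%:E))%E.
    rewrite [RHS]integral_mkcond; apply: eq_integral => t _.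
    rewrite patchE indicE [in LHS]indicE [in RHS]indicE.
    rewrite [in LHS]mem_setE [in LHS]mem_setE !in_itv/= !andbT subr_ge0.
    rewrite !mem_setE !in_itv/= !andbT.
    by case: ifP => _; rewrite ?mulr1 ?mulr0 ?mul0r// EFinM.
  rewrite ge0_integralZr//=.
  - by rewrite integral_step_function// -EFinM mulrC.
  - by apply/measurable_EFinP; exact: measurable_indic.
  - by rewrite lee_fin.
move=> ->; rewrite [RHS]integral_mkcond; apply: eq_integral => t _.
rewrite patchE mem_setE; case: ifPn => [tq|/negbTE tq].
  apply: eq_integral => y _; rewrite /f/= !indicE.
  have -> : (y \in [set y | Y y <= t]) = (Y y <= t).
    by apply/idP/idP; rewrite inE.
  by rewrite !mem_setE tq mulr1 in_itv/= andbT subr_ge0.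
rewrite integral0_eq// => y _.
by rewrite /f/= [\1_`[0, q] t]indicE mem_setE tq mulr0.
Qed.

End layer_cake.

Section layer_cake_probability.
Context {R : realType} {d : measure_display} {T : measurableType d}.
Notation leb := (@lebesgue_measure R).
Variables (P : probability T R) (Y : T -> R).
Hypothesis mY : measurable_fun [set: T] Y.
Hypothesis Y0 : forall y, 0 <= Y y.

Lemma measurable_sublevel t : measurable [set y | Y y <= t].
Proof.
have := mY measurableT (measurable_itv `]-oo, t]).
by rewrite setTI; congr measurable.
Qed.

Lemma bounded_mfun_sublevel t : bounded_mfun (\1_[set y | Y y <= t] : T -> R).
Proof. exact/bounded_mfun_indic/measurable_sublevel. Qed.

Lemma bounded_mfun_hinge q : bounded_mfun (fun y => Num.max 0 (q - Y y)).
Proof.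
split.
  apply: measurable_maxr => //; exact: measurable_funB.
exists `|q| => y; rewrite ger0_norm ?le_max ?lexx// ge_max normr_ge0/=.
by rewrite (le_trans _ (ler_norm q))// gerBl.
Qed.

Lemma layer_cake_expectation (q : R) (g : T -> R) : bounded_mfun g ->
  (forall y, 0 <= g y) ->
  \int[P]_y (g y * Num.max 0 (q - Y y)) =
  \int[leb]_(t in `[0, q]) \int[P]_y (g y * \1_[set y | Y y <= t] y).
Proof.
move=> bg g0; have [mg _] := bg; rewrite [LHS]/Rintegral layer_cake//.
congr fine; apply: eq_integral => t _; rewrite /Rintegral fineK//.
apply: integrable_fin_num => //.
apply: (@bounded_mfun_probability _ _ _ P (fun y => g y * \1_[set y | Y y <= t] y)).
exact: bounded_mfunM (bounded_mfun_sublevel _).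
Qed.

End layer_cake_probability.

(** * Quantiles of a distribution function on the half-line *)

Section quantile.
Context {R : realType} (F : R -> R) (m T0 : R).
Notation leb := (@lebesgue_measure R).
Hypothesis F_nd : forall s t, s <= t -> F s <= F t.
Hypothesis F_neg : forall t, t < 0 -> F t = 0.
Hypothesis F_ge0 : forall t, 0 <= F t.
Hypothesis F_rc : forall t u, (forall s, t < s -> u <= F s) -> u <= F t.
Hypothesis m0 : 0 < m.
Hypothesis FT0 : m <= F T0.

Let Q u := inf [set t | u <= F t].

(** The Galois connection between quantile and distribution function: right continuity puts the
    infimum into the set, and [0 < u] with [F = 0] on the negative axis bounds the set from
    below. *)
Lemma quantile_le u t : 0 < u -> u <= m -> (Q u <= t) = (u <= F t).
Proof.
move=> u0 um; have ne : [set t | u <= F t] !=set0.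
  by exists T0; exact: le_trans FT0.
apply/idP/idP => [Qt|uF].
  apply: F_rc => s ts.
  have [r /= ur rs] := inf_lt ne (le_lt_trans Qt ts).
  by rewrite (le_trans ur)// F_nd// ltW.
apply: ge_inf => //; exists 0 => r /= ur; rewrite leNgt; apply/negP => r0.
by move: ur; rewrite (F_neg r0) leNgt u0.
Qed.

Lemma quantile_ge0 u : 0 < u -> u <= m -> 0 <= Q u.
Proof.
move=> u0 um; rewrite leNgt; apply/negP => Q0.
have := lexx (Q u); rewrite quantile_le//.
by rewrite (F_neg Q0) leNgt u0.
Qed.

Lemma quantile_le_top u : 0 < u -> u <= m -> Q u <= Q m.
Proof.
move=> u0 um; rewrite quantile_le//; apply: (le_trans um).
by rewrite -quantile_le.
Qed.

Let mF : measurable_fun [set: R] F.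
Proof. by apply: nondecreasing_measurable => // s t _ _; exact: F_nd. Qed.

(* [Q] extended outside [`]0, m[] to a nondecreasing function on the line *)
Let Y u := if u <= 0 then 0 else Q (Num.min u m).

Let min0 u : 0 < u -> 0 < Num.min u m.
Proof. by move=> u0; rewrite lt_min u0. Qed.

Let minm u : Num.min u m <= m.
Proof. by rewrite ge_min lexx orbT. Qed.

Let Y0 u : 0 <= Y u.
Proof.
rewrite /Y; case: (leP u 0) => // u0.
exact: (quantile_ge0 (min0 u0) (minm u)).
Qed.

Let Y_nd : nondecreasing_fun Y.
Proof.
move=> s t st; rewrite {1}/Y; case: (leP s 0) => s0; first exact: Y0.
have t0 := lt_le_trans s0 st.
rewrite /Y (leNgt t 0) t0/= (quantile_le _ (min0 s0) (minm s)).
apply: (@le_trans _ _ (Num.min t m)).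
  by rewrite le_min !ge_min st lexx orbT.
by rewrite -(quantile_le _ (min0 t0) (minm t)).
Qed.

Let YE u : 0 < u -> u < m -> Y u = Q u.
Proof. by move=> u0 um; rewrite /Y leNgt u0/= min_l// ltW. Qed.

(** The layer cake formula is applied to Lebesgue measure on []0, m[] and the variable [Q]. By the
    Galois connection, the set of [u] in []0, m[] with [Q u <= t] has measure [min(F t, m)]. *)
Lemma integral_quantile :
  \int[leb]_(u in `]0, m[) Q u = m * Q m - \int[leb]_(t in `[0, Q m]) F t.
Proof.
set q := Q m.
have q0 : 0 <= q by exact: quantile_ge0.
have mI : measurable (`]0, m[%classic : set (measurableTypeR R)) by [].
have Ioo : (leb `]0%R, m[ < +oo)%E.
  by rewrite lebesgue_measure_itv/=; case: ifP => _; rewrite ltry.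
have mY : measurable_fun [set: measurableTypeR R] Y.
  exact: nondecreasing_measurable.
have mi : measurable_fun [set: measurableTypeR R]
    (\1_(`]0, m[%classic : set (measurableTypeR R)) : _ -> R).
  exact: measurable_indic.
have i0 (u : measurableTypeR R) : 0 <= (\1_(`]0, m[%classic : set (measurableTypeR R)) u : R).
  by [].
have := @layer_cake R _ (measurableTypeR R) leb q (\1_(`]0, m[%classic : set (measurableTypeR R)))
  Y mi i0 mY Y0.
have -> : (\int[leb]_y (\1_(`]0, m[%classic : set (measurableTypeR R)) y *
      Num.max 0 (q - Y y))%R%:E =
    \int[leb]_(u in `]0%R, m[) (q - Q u)%R%:E)%E.
  rewrite [RHS]integral_mkcond; apply: eq_integral => u _.
  rewrite patchE indicE; case: ifPn => [|_]; last by rewrite mul0r.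
  rewrite inE/= in_itv/= mul1r => /andP[u0 um].
  by rewrite YE// max_r// subr_ge0 quantile_le_top// ltW.
have -> : (\int[leb]_(t in `[0%R, q]) \int[leb]_y
     (\1_(`]0, m[%classic : set (measurableTypeR R)) y * \1_[set u | (Y u <= t)%R] y)%R%:E =
    \int[leb]_(t in `[0%R, q]) (F t)%:E)%E.
  transitivity (\int[leb]_(t in `[0%R, q]) (Num.min (F t) m)%:E)%E.
    apply: eq_integral => t _.
    transitivity (\int[leb]_(u in `]0%R, m[)
        (\1_(`]-oo, F t]%classic : set (measurableTypeR R)) u)%:E)%E.
      rewrite [RHS]integral_mkcond; apply: eq_integral => u _.
      rewrite patchE [X in (X * _)%R%:E]indicE; case: ifPn => [|_]; last by rewrite mul0r.
      rewrite inE/= in_itv/= mul1r !indicE => /andP[u0 um]; congr ((nat_of_bool _)%:R%:E).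
      by apply/idP/idP; rewrite !inE/= in_itv/= YE// quantile_le// ltW.
    rewrite integral_indic//=.
    have [Fm|Fm] := ltP (F t) m.
      rewrite (_ : _ `&` _ = `]0, F t]%classic); last first.
        apply/seteqP; split => u /=; rewrite !in_itv/=.
          by move=> [uF /andP[-> _]].
        by move=> /andP[-> uF]; rewrite uF (le_lt_trans uF).
      rewrite lebesgue_measure_itv/= lte_fin oppr0 adde0.
      by case: ltP => // F0; congr EFin; apply/le_anti; rewrite F0 F_ge0.
    rewrite (_ : _ `&` _ = `]0, m[%classic); last first.
      apply/seteqP; split => u /=; rewrite !in_itv/=; first by case.
      by move=> /andP[-> um]; rewrite um (le_trans (ltW um)).
    by rewrite lebesgue_measure_itv/= lte_fin m0 oppr0 adde0.
  have mFm : measurable_fun [set: measurableTypeR R] (fun t => (Num.min (F t) m)%:E).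
    by apply/measurable_EFinP; exact: measurable_minr.
  (* The right end is dropped because [F t < m] holds for [t < Q m], while an atom may make
     [F (Q m)] exceed [m]. *)
  rewrite -[LHS]integral_itv_bndo_bndc; last exact: measurable_funTS.
  rewrite -[RHS]integral_itv_bndo_bndc; last first.
    by apply: measurable_funTS; exact/measurable_EFinP.
  apply: eq_integral => t; rewrite inE/= in_itv/= => /andP[t0 tq].
  by rewrite min_l// leNgt; apply/negP => /ltW mF'; move: tq; rewrite ltNge quantile_le ?mF'.
move=> /(congr1 fine) E.
rewrite [in RHS]/Rintegral -E.
have bQ : leb.-integrable (`]0, m[%classic : set (measurableTypeR R)) (EFin \o Q).
  apply: (@eq_integrable _ _ _ leb _ mI (EFin \o Y)).
    by move=> u; rewrite inE/= in_itv/= => /andP[u0 um]; rewrite /= YE.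
  apply: measurable_bounded_integrable => //; first exact: measurable_funTS.
  exists q; split; first exact: num_real.
  move=> z qz u /=; rewrite in_itv/= => /andP[u0 um].
  rewrite YE// ger0_norm ?quantile_ge0//; last exact: ltW.
  by apply: le_trans (ltW qz); apply: quantile_le_top => //; exact: ltW.
have bq : leb.-integrable (`]0, m[%classic : set (measurableTypeR R)) (EFin \o (fun _ => q)).
  by apply: bounded_mfun_integrable => //; exact: bounded_mfun_cst.
rewrite -[fine _]/(\int[leb]_(u in `]0, m[) (q - Q u)) RintegralB// Rintegral_cst//.
rewrite /= lebesgue_measure_itv/= lte_fin m0 oppr0 adde0/=.
by rewrite mulrC opprB addrC subrK.
Qed.

End quantile.

Lemma sqdist_ge0 (R : realType) (d : nat) (x y : d.-tuple R) : 0 <= sqdist x y.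
Proof. by apply: sumr_ge0 => i _; exact: sqr_ge0. Qed.

Lemma measurable_sqdist (R : realType) (d : nat) (x : d.-tuple R) :
  measurable_fun [set: d.-tuple R] (sqdist x).
Proof.
apply: measurable_sum => i; apply: measurable_funX; apply: measurable_funB => //.
exact: measurable_tnth.
Qed.

#[local] Hint Resolve sqdist_ge0 measurable_sqdist : core.

(** * The concave function [G] and its maximum *)

Section dtm.
Context {R : realType} {d : nat} (P : probability (d.-tuple R) R)
  (x : d.-tuple R) (m : R).
Hypotheses (m0 : 0 < m) (m1 : m < 1).
Notation leb := (@lebesgue_measure R).
Let F := sqdist_cdf P x.
Let q := sqdist_quantile P x m.
Let Y := sqdist x.

Definition hinge_mean (t : R) : R := \int[P]_y Num.max 0 (t - Y y).
Let G t := m * t - hinge_mean t.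

Let bY t : bounded_mfun (\1_[set y | Y y <= t] : d.-tuple R -> R).
Proof. exact: (bounded_mfun_sublevel (measurable_sqdist x)). Qed.

Let mYt t : measurable [set y | Y y <= t].
Proof. exact: (measurable_sublevel (measurable_sqdist x)). Qed.

Lemma sqdist_cdfE t : F t = \int[P]_y \1_[set y | Y y <= t] y.
Proof. by rewrite expect_indic. Qed.

Lemma sqdist_cdf_nd s t : s <= t -> F s <= F t.
Proof.
move=> st; rewrite /F /sqdist_cdf fine_le ?fin_num_measure ?le_measure ?inE//; try exact: mYt.
by move=> y /= /le_trans; apply.
Qed.

Lemma sqdist_cdf_ge0 t : 0 <= F t.
Proof. by rewrite fine_ge0. Qed.

Lemma sqdist_cdf_le1 t : F t <= 1.
Proof.
rewrite -[leRHS]/(fine 1%E) fine_le ?fin_num_measure ?probability_le1//; exact: mYt.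
Qed.

Lemma sqdist_cdf_neg t : t < 0 -> F t = 0.
Proof.
move=> t0; rewrite /F /sqdist_cdf (_ : [set y | _] = set0) ?measure0//.
apply/seteqP; split => y //= yt.
by have := lt_le_trans t0 (sqdist_ge0 x y); rewrite ltNge yt.
Qed.

Let Y' : {RV P >-> R} :=
  HB.pack Y (isMeasurableFun.Build _ _ _ _ Y (measurable_sqdist x)).

Let cdfE t : cdf Y' t = (F t)%:E.
Proof.
by rewrite /F /sqdist_cdf fineK ?fin_num_measure//.
Qed.

Lemma sqdist_cdf_rc t u : (forall s, t < s -> u <= F s) -> u <= F t.
Proof.
move=> tu; rewrite -lee_fin -cdfE; apply: (cvge_to_ge (@cdf_right_continuous _ _ _ P Y' t)).
near=> s; rewrite cdfE lee_fin; apply: tu.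
by near: s; exact: nbhs_right_gt.
Unshelve. all: by end_near. Qed.

Lemma sqdist_cdf_top : exists T0, m <= F T0.
Proof.
have /fine_cvg Fy := @cvg_cdfy1 _ _ _ P Y'.
have [M [_ MF]] := cvgr_gt _ Fy _ m1.
exists (M + 1); have := MF (M + 1); rewrite /= cdfE ltrDl => /(_ ltr01) /ltW.
by [].
Qed.

Lemma sqdist_quantile_le u t : 0 < u -> u <= m ->
  (sqdist_quantile P x u <= t) = (u <= F t).
Proof.
have [T0 FT0] := sqdist_cdf_top.
exact: (quantile_le sqdist_cdf_nd sqdist_cdf_neg sqdist_cdf_rc FT0).
Qed.

Lemma hinge_meanE t : hinge_mean t = \int[leb]_(s in `[0, t]) F s.
Proof.
have := @layer_cake_expectation _ _ _ P Y (measurable_sqdist x) (sqdist_ge0 x) t (fun=> 1)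
  (bounded_mfun_cst _) (fun=> ler01).
rewrite (_ : (fun s => _) = F); last first.
  by apply/funext => s; under eq_Rintegral do rewrite mul1r; rewrite sqdist_cdfE.
by move=> <-; under [RHS]eq_Rintegral do rewrite mul1r.
Qed.

Lemma dtm_sqrE : dtm P m x ^+ 2 = m^-1 * G q.
Proof.
have [T0 FT0] := sqdist_cdf_top.
rewrite /dtm sqr_sqrtr.
  rewrite /G hinge_meanE -(integral_quantile sqdist_cdf_nd sqdist_cdf_neg
    sqdist_cdf_ge0 sqdist_cdf_rc m0 FT0).
  by [].
apply: mulr_ge0; first by rewrite invr_ge0 ltW.
apply: Rintegral_ge0 => u /=.
rewrite in_itv/= => /andP[u0 um].
exact: (quantile_ge0 sqdist_cdf_nd sqdist_cdf_neg sqdist_cdf_rc FT0 u0 (ltW um)).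
Qed.

(** The mean of the pointwise convexity bound [max(0, t - Y) - max(0, s - Y) >= (t - s) 1{Y <=
    s}]. *)
Lemma hinge_supergradient s t : G t - G s <= (t - s) * (m - F s).
Proof.
have bh r : bounded_mfun (fun y => Num.max 0 (r - Y y)).
  exact: (bounded_mfun_hinge (measurable_sqdist x) (sqdist_ge0 x)).
suff : (t - s) * F s <= hinge_mean t - hinge_mean s by rewrite /G; nra.
rewrite sqdist_cdfE -expectZ// -expectB//; apply: expect_le.
- by apply: bounded_mfunM => //; exact: bounded_mfun_cst.
- exact: bounded_mfunB.
move=> y; rewrite indicE; have [|] := boolP (y \in _).
  rewrite inE/= mulr1 => ys; rewrite (max_r (_ : 0 <= s - Y y)) ?subr_ge0//.
  have : t - Y y <= Num.max 0 (t - Y y) by rewrite le_max lexx orbT.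
  lra.
rewrite notin_setE/= mulr0 => /negP; rewrite -ltNge => ys.
by rewrite [X in _ - X]max_l ?subr0 ?le_max ?lexx// subr_le0 ltW.
Qed.

Lemma hinge_lipschitz s t : G t - G s <= `|t - s|.
Proof.
apply: (le_trans (hinge_supergradient s t)); apply: (le_trans (ler_norm _)).
rewrite normrM ler_piMr// ler_norml.
have := sqdist_cdf_ge0 s; have := sqdist_cdf_le1 s; rewrite -/F.
by move: m0 m1; move: (F s) => f *; apply/andP; split; lra.
Qed.

(** To the right of [q] the slope [m - F q] is nonpositive. To the left, [F q >= m] gives no
    information, so [t] is compared with a point [s < q], where [F s < m], within [e] of [q]; the
    Lipschitz bound then leads from [s] to [q]. *)
Lemma hinge_max t : G t <= G q.
Proof.
have Fq : m <= F q by rewrite -sqdist_quantile_le.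
have [qt|tq] := leP q t.
  rewrite -subr_le0; apply: (le_trans (hinge_supergradient _ _)).
  by rewrite mulr_ge0_le0 ?subr_ge0 ?subr_le0.
apply/ler_addgt0Pr => e e0.
pose s := Num.max t (q - e / 2).
have sq : s < q by rewrite /s gt_max tq/= ltrBlDr ltrDl divr_gt0.
have ts : t <= s by rewrite /s le_max lexx.
have es : q - s <= e by rewrite lerBlDr -lerBlDl /s le_max; apply/orP; right; lra.
have Fs : F s < m by rewrite ltNge -sqdist_quantile_le// -ltNge.
have := hinge_supergradient s t; have := hinge_lipschitz q s.
rewrite (ltr0_norm (_ : s - q < 0)) ?subr_lt0//.
have : (t - s) * (m - F s) <= 0 by rewrite mulr_le0_ge0 ?subr_le0// subr_ge0 ltW.
lra.
Qed.

(** The supergradient at [q0] bounds the gain at any point within [e] of [q0]. Beyond [q0 - e] or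
    [q0 + e] the hypotheses fix the sign of the slope, so [G] is no larger there than at that end.
    It is meant for an empirical [P], with [q0] the quantile of the sampled law. *)
Lemma hinge_max_near (q0 e : R) : F (q0 - e) < m -> m <= F (q0 + e) ->
  0 <= G q - G q0 <= e * `|m - F q0|.
Proof.
move=> Fl Fr; apply/andP; split; first by rewrite subr_ge0 hinge_max.
have e0 : 0 <= e.
  rewrite leNgt; apply/negP => e0.
  have ee : q0 + e <= q0 - e by lra.
  by have := le_lt_trans (le_trans Fr (sqdist_cdf_nd ee)) Fl; rewrite ltxx.
have mid t : `|t - q0| <= e -> G t - G q0 <= e * `|m - F q0|.
  move=> te; apply: (le_trans (hinge_supergradient _ _)).
  by apply: (le_trans (ler_norm _)); rewrite normrM ler_wpM2r.
have [ql|] := ltP q (q0 - e).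
  have := hinge_supergradient (q0 - e) q.
  have : (q - (q0 - e)) * (m - F (q0 - e)) <= 0.
    by apply: mulr_le0_ge0; rewrite ?subr_le0 ?subr_ge0; exact: ltW.
  have := mid (q0 - e); rewrite addrAC subrr sub0r normrN ger0_norm// => /(_ (lexx _)).
  lra.
have [qr _|qr ql] := ltP (q0 + e) q.
  have := hinge_supergradient (q0 + e) q.
  have : (q - (q0 + e)) * (m - F (q0 + e)) <= 0.
    by apply: mulr_ge0_le0; rewrite ?subr_le0 ?subr_ge0//; exact: ltW.
  have := mid (q0 + e); rewrite addrAC subrr add0r ger0_norm// => /(_ (lexx _)).
  lra.
by apply: mid; rewrite ler_norml; lra.
Qed.

End dtm.

(** * The empirical measure *)

Section empirical.
Context {R : realType} {d : nat} (y : nat -> d.-tuple R) (n : nat).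
Hypothesis n0 : (0 < n)%N.

Lemma integral_empirical (f : d.-tuple R -> R) : measurable_fun [set: _] f ->
  (forall z, 0 <= f z) ->
  (\int[empirical y n]_z (f z)%:E = (n%:R^-1 * \sum_(i < n) f (y i))%R%:E)%E.
Proof.
move=> mf f0; have mf' : measurable_fun [set: _] (EFin \o f) by exact/measurable_EFinP.
rewrite /empirical ge0_integral_mscale//=; last by move=> z _; rewrite lee_fin.
rewrite ge0_integral_measure_sum//=; last by move=> z _; rewrite lee_fin.
under eq_bigr do rewrite integral_dirac//= diracT mul1e.
by rewrite sumEFin.
Qed.

Lemma empirical_setT : empirical y n setT = 1%E.
Proof.
have E := @integral_empirical (fun=> 1) (measurable_cst _) (fun=> ler01).
have E' : (\int[empirical y n]_z 1%:E = 1%:E * empirical y n setT)%E.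
  exact: integral_cst.
rewrite -[LHS]mul1e -E' E.
by rewrite sumr_const card_ord mulVf// pnatr_eq0 -lt0n.
Qed.

(** The empirical measure repackaged as a probability, so that all results on [G] apply to it. *)
Definition empirical_probability : probability (d.-tuple R) R :=
  HB.pack (Measure.sort (empirical y n))
    (@Measure_isProbability.Build _ _ R (empirical y n) empirical_setT).

Lemma empirical_hinge_mean (x : d.-tuple R) (t : R) :
  hinge_mean empirical_probability x t =
  n%:R^-1 * \sum_(i < n) Num.max 0 (t - sqdist x (y i)).
Proof.
rewrite /hinge_mean /Rintegral integral_empirical//.
  by have [] := bounded_mfun_hinge (measurable_sqdist x) (sqdist_ge0 x) t.
by move=> z; rewrite le_max lexx.
Qed.

Lemma empirical_cdf (x : d.-tuple R) (t : R) :
  sqdist_cdf (empirical y n) x t =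
  n%:R^-1 * \sum_(i < n) \1_[set z | sqdist x z <= t] (y i).
Proof.
rewrite -[LHS]/(sqdist_cdf empirical_probability x t) sqdist_cdfE.
rewrite /Rintegral integral_empirical//.
by have [] := bounded_mfun_sublevel (measurable_sqdist x) t.
Qed.

Lemma empirical_dtm (x : d.-tuple R) (m : R) :
  dtm (empirical y n) m x = dtm empirical_probability m x.
Proof. by []. Qed.

End empirical.

(** * The variance formula *)

Section variance.
Context {R : realType} {d : nat} (P : probability (d.-tuple R) R)
  (x : d.-tuple R) (m : R).
Notation leb := (@lebesgue_measure R).
Let F := sqdist_cdf P x.
Let q := sqdist_quantile P x m.
Let Y := sqdist x.
Let psi y := Num.max 0 (q - Y y).

Let bY t : bounded_mfun (\1_[set y | Y y <= t] : d.-tuple R -> R).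
Proof. exact: (bounded_mfun_sublevel (measurable_sqdist x)). Qed.

Let bpsi : bounded_mfun psi.
Proof. exact: (bounded_mfun_hinge (measurable_sqdist x) (sqdist_ge0 x)). Qed.

Let psi0 y : 0 <= psi y. Proof. by rewrite /psi le_max lexx. Qed.

Let LC := @layer_cake_expectation _ _ _ P Y (measurable_sqdist x) (sqdist_ge0 x) q.

Let K t := \int[P]_y (psi y * \1_[set y | Y y <= t] y).

(** The layer cake formula with an indicator as weight; the product of the indicators at levels [s]
    and [t] is the indicator at level [min(s, t)]. *)
Let KE t : K t = \int[leb]_(s in `[0, q]) F (Num.min s t).
Proof.
rewrite /K; under eq_Rintegral do rewrite mulrC.
rewrite (LC (bY t)) //; apply: eq_Rintegral => s _.
rewrite /F sqdist_cdfE; apply: eq_Rintegral => y _.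
rewrite !indicE -natrM mulnb; congr ((nat_of_bool _)%:R).
have memE r : (y \in [set z | Y z <= r]) = (Y y <= r).
  by apply/idP/idP; rewrite inE.
by rewrite !memE le_min andbC.
Qed.

Let hinge_mean_sqr : \int[P]_y (psi y ^+ 2) = \int[leb]_(t in `[0, q]) K t.
Proof. by under eq_Rintegral do rewrite expr2; rewrite (LC bpsi). Qed.

Let K_bounded : bounded_mfun (K : measurableTypeR R -> R).
Proof.
have bpY t : bounded_mfun (fun y => psi y * \1_[set y | Y y <= t] y).
  exact: bounded_mfunM.
have mem_le t y : (\1_[set y | Y y <= t] y : R) <= 1 by rewrite indicE lern1 leq_b1.
split.
  apply: nondecreasing_measurable => // s t st; apply: expect_le => // y.
  rewrite ler_wpM2l// !indicE ler_nat.
  have [|//] := boolP (y \in [set z | Y z <= s]).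
  by rewrite inE/= => ys; rewrite mem_set//=; exact: le_trans st.
exists (hinge_mean P x q) => t; rewrite ger0_norm.
  by apply: expect_le => // y; rewrite ler_piMr.
by apply: Rintegral_ge0 => y _; rewrite mulr_ge0.
Qed.

Let F_bounded : bounded_mfun (F : measurableTypeR R -> R).
Proof.
split.
  by apply: nondecreasing_measurable => // s t; exact: sqdist_cdf_nd.
by exists 1 => t; rewrite ger0_norm ?sqdist_cdf_ge0 ?sqdist_cdf_le1.
Qed.

(** A second use of the layer cake formula, now with weight [psi], shows that the double integral of
    [F (min s t)] is the mean of [psi^2]; that of [F s * F t] is the squared mean of [psi]. *)
Lemma dtm_varianceE : dtm_variance P m x =
  \int[P]_y ((m^-1 * (hinge_mean P x q - psi y)) ^+ 2).
Proof.
have bh : bounded_mfun (fun y : d.-tuple R => hinge_mean P x q) by exact: bounded_mfun_cst.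
have bc (c : R) : bounded_mfun (fun y : d.-tuple R => c) by exact: bounded_mfun_cst.
have bcR (c : R) : bounded_mfun (fun y : measurableTypeR R => c) by exact: bounded_mfun_cst.
under [RHS]eq_Rintegral do rewrite exprMn exprVn sqrrB -mulr_natl.
rewrite [RHS]expectZ; last first.
  apply: bounded_mfunD; last exact: bounded_mfunX.
  apply: bounded_mfunB; first exact: bounded_mfunX.
  by apply: bounded_mfunM => //; exact: bounded_mfunM.
rewrite /dtm_variance; congr (_ * _).
rewrite expectD; last exact: bounded_mfunX.
  rewrite expectB; last by apply: bounded_mfunM => //; exact: bounded_mfunM.
    rewrite !expectZ ?expect_cst//; last exact: bounded_mfunM.
    have qoo : (leb `[0%R, q] < +oo)%E.
      by rewrite /= lebesgue_measure_itv/=; case: ifP => _; rewrite ltry.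
    have mq : measurable (`[0, q]%classic : set (measurableTypeR R)) by [].
    have qint (f : measurableTypeR R -> R) : bounded_mfun f ->
        leb.-integrable `[0, q] (EFin \o f) by exact: bounded_mfun_integrable.
    have inner t : \int[leb]_(s in `[0, q]) (F (Num.min s t) - F s * F t) =
        K t - hinge_mean P x q * F t.
      rewrite RintegralB//.
      - by rewrite RintegralZr ?hinge_meanE ?KE//; exact: qint.
      - apply: (qint (fun s => F (Num.min s t))).
        apply: (bounded_mfun_comp
          (X := fun s : measurableTypeR R => (Num.min s t : measurableTypeR R)))
          F_bounded.
        by apply: measurable_minr.
      - by apply: (qint (fun s => F s * F t)); exact: bounded_mfunM.
    under eq_Rintegral do rewrite inner.
    rewrite RintegralB//; [|exact: qint|]; last first.
      by apply: (qint (fun t => hinge_mean P x q * F t)); exact: bounded_mfunM.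
    rewrite RintegralZl//; last exact: qint.
    by rewrite -hinge_meanE -hinge_mean_sqr -/(hinge_mean P x q); ring.
  exact: bc.
apply: bounded_mfunB => //; apply: bounded_mfunM => //; exact: bounded_mfunM.
Qed.

End variance.

(** * Consequences of differentiability at the quantile *)

(** Difference quotients of small step are positive, which gives strict inequalities close to [q];
    monotonicity carries them to any distance [e]. *)
Lemma derive_gt0_strict (R : realType) (F : R -> R) (q e : R) :
  {homo F : s t / s <= t} -> derivable F q 1 -> 0 < F^`()%classic q -> 0 < e ->
  F (q - e) < F q < F (q + e).
Proof.
move=> F_nd dF; rewrite derive1E => F'0 e0.
have [r /= r0 rF] := cvgr_gt _ dF _ F'0.
pose h := Num.min e (r / 2).
have h0 : 0 < h by rewrite lt_min e0 divr_gt0.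
have hr : h < r by rewrite /h gt_min; apply/orP; right; lra.
have he : h <= e by rewrite /h ge_min lexx.
have incr k : `|k| = h -> 0 < k^-1 * (F (k + q) - F q).
  move=> kh; have := rF k; rewrite /= sub0r normrN kh => /(_ hr).
  rewrite /GRing.scale/= mulr1; apply.
  by rewrite -normr_gt0 kh.
apply/andP; split.
  have := incr (- h); rewrite normrN gtr0_norm// => /(_ erefl).
  rewrite nmulr_rgt0 ?invr_lt0 ?oppr_lt0// subr_lt0; apply: le_lt_trans.
  by apply: F_nd; lra.
have := incr h; rewrite gtr0_norm// => /(_ erefl).
rewrite pmulr_rgt0 ?invr_gt0// subr_gt0 => /lt_le_trans; apply.
by apply: F_nd; lra.
Qed.

Section regular_quantile.
Context {R : realType} {d : nat} (P : probability (d.-tuple R) R)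
  (x : d.-tuple R) (m : R).
Hypotheses (m0 : 0 < m) (m1 : m < 1).
Let F := sqdist_cdf P x.
Let q := sqdist_quantile P x m.
Let Y := sqdist x.
Hypothesis Fq_derivable : derivable F q 1.

Let F_left (r : R) : r < F q -> exists2 e, 0 < e & r < F (q - e).
Proof.
move=> rq.
have Fc : {for q, continuous F}.
  exact/differentiable_continuous/derivable1_diffP.
have [e /= e0 He] := cvgr_gt _ Fc _ rq.
exists (e / 2); first by rewrite divr_gt0.
apply: He; rewrite /= opprB addrC subrK gtr0_norm ?divr_gt0//; lra.
Qed.

(** If [F q] exceeded [m], so would [F (q - e)] for some [e > 0] by continuity, and [q] would not be
    the infimum. *)
Lemma sqdist_cdf_quantile : F q = m.
Proof.
apply/le_anti; rewrite -[X in _ && X](sqdist_quantile_le P x m1)//.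
rewrite lexx andbT leNgt; apply/negP => /F_left[e e0].
apply/negP; rewrite -leNgt ltW// ltNge -(sqdist_quantile_le P x m1)// -ltNge.
by rewrite ltrBlDr ltrDl.
Qed.

(** Beyond [q], on an event of probability [1 - m], the hinge vanishes and the influence function is
    the constant [k]. This constant is positive because some mass lies below [q - e], where the
    hinge is at least [e]. *)
Lemma dtm_variance_gt0 : 0 < dtm_variance P m x.
Proof.
have [|e e0 Fe] := @F_left 0; first by rewrite sqdist_cdf_quantile.
have bY t : bounded_mfun (\1_[set y | Y y <= t] : d.-tuple R -> R).
  exact: (bounded_mfun_sublevel (measurable_sqdist x)).
have bc (c : R) : bounded_mfun (fun y : d.-tuple R => c) by exact: bounded_mfun_cst.
have bpsi : bounded_mfun (fun y => Num.max 0 (q - Y y)).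
  exact: (bounded_mfun_hinge (measurable_sqdist x) (sqdist_ge0 x)).
have H0 : 0 < hinge_mean P x q.
  apply: (@lt_le_trans _ _ (e * F (q - e))); first by rewrite mulr_gt0.
  rewrite /F sqdist_cdfE -expectZ//; apply: expect_le => //.
    exact: bounded_mfunM.
  move=> y; rewrite indicE; have [|_] := boolP (y \in _).
    by rewrite inE/= mulr1 le_max => Yq; apply/orP; right; rewrite /Y; lra.
  by rewrite mulr0 le_max lexx.
rewrite dtm_varianceE -/q.
set k := m^-1 * hinge_mean P x q.
have k0 : 0 < k by rewrite mulr_gt0// invr_gt0.
apply: (@lt_le_trans _ _ (k ^+ 2 * (1 - F q))).
  by rewrite sqdist_cdf_quantile mulr_gt0 ?subr_gt0// exprn_gt0.
rewrite /F sqdist_cdfE -[X in X - _](expect_cst P) -expectB// -expectZ; last exact: bounded_mfunB.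
apply: expect_le.
- by apply: bounded_mfunM => //; exact: bounded_mfunB.
- by apply: bounded_mfunX; apply: bounded_mfunM => //; exact: bounded_mfunB.
move=> y; rewrite indicE; have [|] := boolP (y \in _).
  by rewrite subrr mulr0 sqr_ge0.
rewrite notin_setE/= => /negP; rewrite -ltNge => qY.
by rewrite subr0 mulr1 max_l ?subr0// subr_le0 ltW.
Qed.

End regular_quantile.

(** * Limit distribution *)

Section ramp.
Context {R : realType}.
Implicit Types a e x y : R.

(** A Lipschitz function between the indicators of [x <= a] and [x <= a + e]. *)
Definition ramp a e x : R := Num.max 0 (Num.min 1 ((a + e - x) / e)).

Lemma ramp01 a e x : 0 <= ramp a e x <= 1.
Proof. by rewrite /ramp le_max lexx/= ge_max ler01 ge_min lexx. Qed.

Lemma ramp_left a e x : 0 < e -> x <= a -> ramp a e x = 1.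
Proof.
move=> e0 xa; rewrite /ramp min_l ?max_r// ler_pdivlMr// mul1r; lra.
Qed.

Lemma ramp_right a e x : 0 < e -> a + e <= x -> ramp a e x = 0.
Proof.
move=> e0 xa; rewrite /ramp max_l// ge_min; apply/orP; right.
by rewrite pmulr_lle0 ?invr_gt0// subr_le0.
Qed.

Lemma ramp_lip a e x y : 0 < e ->
  `|ramp a e x - ramp a e y| <= e^-1 * `|x - y|.
Proof.
move=> e0; have -> : e^-1 * `|x - y| = `|(a + e - x) / e - (a + e - y) / e|.
  have -> : (a + e - x) / e - (a + e - y) / e = e^-1 * (y - x).
    by field; rewrite gt_eqF.
  by rewrite normrM gtr0_norm ?invr_gt0// distrC.
rewrite /ramp; set u := (_ - x) / e; set v := (_ - y) / e.
have := ler_norm (u - v); have := ler_norm (- (u - v)); rewrite normrN.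
move: `|u - v| => z; rewrite ler_norml /Num.max /Num.min.
by do !case: ifP; move=> *; apply/andP; split; lra.
Qed.

End ramp.

Section normal_ramp.
Context {R : realType} (s : R).
Notation leb := (@lebesgue_measure R).
Let p : measurableTypeR R -> R := normal_pdf 0 s.
Let N a := fine (normal_prob 0 s `]-oo, a]%classic).

Let NE a : N a = \int[leb]_x (\1_(`]-oo, a]%classic : set (measurableTypeR R)) x * p x).
Proof.
rewrite /N /normal_prob -[LHS]/(\int[leb]_(x in `]-oo, a]) p x) Rintegral_mkcond.
apply: eq_Rintegral => x _; rewrite patchE indicE.
by case: ifP => _; rewrite ?mul1r ?mul0r.
Qed.

Let intp (g : measurableTypeR R -> R) : measurable_fun setT g ->
  (forall x, 0 <= g x <= 1) -> leb.-integrable setT (EFin \o (fun x => g x * p x)).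
Proof.
move=> mg g01; apply: (le_integrable _ _ _ (integrable_normal_pdf 0 s)) => //=.
  apply/measurable_EFinP; apply: measurable_funM => //.
  exact: measurable_normal_pdf.
move=> x _; have /andP[g0 g1] := g01 x; rewrite lee_fin normrM (ger0_norm g0).
by rewrite ler_piMl.
Qed.

Lemma measurable_ramp (a e : R) : 0 < e -> measurable_fun [set: R] (ramp a e).
Proof.
move=> e0; apply: continuous_measurable_fun.
by apply: (@lipschitz_continuous _ (ramp a e) e^-1) => x y; exact: ramp_lip.
Qed.

Let step01 a (x : measurableTypeR R) :
  0 <= (\1_(`]-oo, a]%classic : set (measurableTypeR R)) x : R) <= 1.
Proof. by rewrite indicE ler0n lern1 leq_b1. Qed.

Let mstep a : measurable_fun setT
  (\1_(`]-oo, a]%classic : set (measurableTypeR R)) : measurableTypeR R -> R).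
Proof. exact: measurable_indic. Qed.

Lemma normal_ramp_ge a e : 0 < e -> N a <= \int[leb]_x (ramp a e x * p x).
Proof.
move=> e0; rewrite NE; apply: le_Rintegral => //.
- exact: intp.
- by apply: intp; [exact: measurable_ramp|exact: ramp01].
move=> x _; rewrite ler_wpM2r ?normal_pdf_ge0// indicE.
have [|_] := boolP (x \in _); last by have /andP[] := ramp01 a e x.
by rewrite inE/= in_itv/= => xa; rewrite ramp_left.
Qed.

Lemma normal_ramp_le a e : 0 < e -> \int[leb]_x (ramp a e x * p x) <= N (a + e).
Proof.
move=> e0; rewrite NE; apply: le_Rintegral => //.
- by apply: intp; [exact: measurable_ramp|exact: ramp01].
- exact: intp.
move=> x _; rewrite ler_wpM2r ?normal_pdf_ge0// indicE.
have [|] := boolP (x \in _); first by have /andP[] := ramp01 a e x.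
rewrite notin_setE/= in_itv/= => /negP; rewrite -ltNge => /ltW xa.
by rewrite ramp_right.
Qed.

End normal_ramp.

(** The squared distance to measure is [1 / m] times the supremum of [G], and by continuity the
    supremum over rational [t] suffices; superlevel sets become countable unions. *)
Lemma measurable_dtm_empirical (R : realType) (d : nat) (disp : measure_display)
    (Omega : measurableType disp) (Pr : probability Omega R)
    (X : nat -> {RV Pr >-> d.-tuple R}) (m : R) (x : d.-tuple R) (n : nat) :
  0 < m -> m < 1 -> (0 < n)%N ->
  measurable_fun [set: Omega]
    (fun w => dtm (empirical (fun i => X i w) n) m x ^+ 2).
Proof.
move=> m0 m1 n0.
pose Pn w := empirical_probability (fun i => X i w) n0.
pose G w t := m * t - n%:R^-1 * \sum_(i < n) Num.max 0 (t - sqdist x (X i w)).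
have GE w t : G w t = m * t - hinge_mean (Pn w) x t.
  by rewrite /G empirical_hinge_mean.
have mG t : measurable_fun [set: Omega] (G ^~ t).
  apply: measurable_funB => //; apply: measurable_funM => //.
  apply: measurable_sum => i; apply: measurable_maxr => //.
  apply: measurable_funB => //; apply: measurableT_comp => //.
  exact: measurable_sqdist.
apply: (measurability (@RGenOInfty.G R)) => [|/= _ [_ [r ->] <-]].
  exact: RGenOInfty.measurableE.
rewrite setTI [X in measurable X](_ : _ =
    \bigcup_(t : rat) [set w | m * r < G w (ratr t)]).
  apply: bigcupT_measurable_rat => t.
  have := mG (ratr t) measurableT _ (measurable_itv `]m * r, +oo[).
  by rewrite setTI; congr measurable; apply/seteqP; split => w /=; rewrite in_itv/= andbT.
apply/seteqP; split => w /=.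
  rewrite in_itv/= andbT empirical_dtm -/(Pn w) dtm_sqrE// -ltr_pdivrMl ?invr_gt0// invrK.
  set q := sqdist_quantile _ _ _ => rG.
  set D := _ - _ in rG.
  have Dr : 0 < D - m * r by rewrite subr_gt0.
  (* [G] is 1-Lipschitz, so a rational closer to [q] than the excess [D - m r] still has a value
     above [m r]. *)
  have qD : q - (D - m * r) < q by rewrite ltrBlDr ltrDl.
  have [t] := rat_in_itvoo qD; rewrite in_itv/= => /andP[tl tr].
  exists t => //=; rewrite GE.
  have := hinge_lipschitz (Pn w) x m0 m1 (ratr t) q.
  rewrite gtr0_norm ?subr_gt0// -/q -/D.
  lra.
move=> [t _ /=]; rewrite in_itv/= andbT empirical_dtm -/(Pn w) dtm_sqrE//.
rewrite -ltr_pdivrMl ?invr_gt0// invrK.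
by rewrite GE => /lt_le_trans; apply; exact: hinge_max.
Qed.

(** * Linearization and conclusion *)

Section dtm_clt.
Context (R : realType) (d : nat) (P : probability (d.-tuple R) R)
  (disp : measure_display) (Omega : measurableType disp)
  (Pr : probability Omega R) (X : nat -> {RV Pr >-> d.-tuple R})
  (m : R) (x : d.-tuple R).
Hypotheses (m0 : 0 < m) (m1 : m < 1) (Xiid : iid P X).
Let F := sqdist_cdf P x.
Let q := sqdist_quantile P x m.
Hypothesis dF : derivable F q 1.
Hypothesis F'0 : 0 < F^`()%classic q.
Let s := Num.sqrt (dtm_variance P m x).

Let Z n w := Num.sqrt n%:R *
  (dtm (empirical (fun i => X i w) n) m x ^+ 2 - dtm P m x ^+ 2).

Let mZ n : measurable_fun [set: Omega] (Z n).
Proof.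
rewrite /Z; case: n => [|n].
  (* For [n = 0] the empirical measure is not a probability, but the factor [sqrt 0] makes [Z]
     zero. *)
  by under eq_fun do rewrite sqrtr0 mul0r; exact: measurable_cst.
apply: measurable_funM => //; apply: measurable_funB => //.
exact: measurable_dtm_empirical.
Qed.

(* The influence function of the squared distance to measure. *)
Let phi y := m^-1 * (hinge_mean P x q - Num.max 0 (q - sqdist x y)).
Let S n w := (Num.sqrt n%:R)^-1 * \sum_(0 <= j < n) phi (X j w).

Let Fn n w t := sqdist_cdf (empirical (fun i => X i w) n) x t.

Let bpsi t : bounded_mfun (fun y => Num.max 0 (t - sqdist x y)).
Proof. exact: (bounded_mfun_hinge (measurable_sqdist x) (sqdist_ge0 x)). Qed.

Let bphi : bounded_mfun phi.
Proof.
apply: bounded_mfunM; first exact: bounded_mfun_cst.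
by apply: bounded_mfunB => //; exact: bounded_mfun_cst.
Qed.

Let phi0 : \int[P]_y phi y = 0.
Proof.
rewrite expectZ; last by apply: bounded_mfunB => //; exact: bounded_mfun_cst.
rewrite expectB//; last exact: bounded_mfun_cst.
by rewrite expect_cst subrr mulr0.
Qed.

Let s_gt0 : 0 < s.
Proof. by rewrite sqrtr_gt0 dtm_variance_gt0. Qed.

Let phi2 : \int[P]_y (phi y ^+ 2) = s ^+ 2.
Proof. by rewrite sqr_sqrtr -?dtm_varianceE// ltW// dtm_variance_gt0. Qed.

(** [Z] is [sqrt n / m] times [max G_n - max G], and [S] is [sqrt n / m] times [G_n q - G q]. As
    [max G = G q], the difference is governed by [hinge_max_near] for the empirical measure. *)
Let remainder n (n0 : (0 < n)%N) e w : Fn n w (q - e) < m -> m <= Fn n w (q + e) ->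
  0 <= Z n w - S n w <= Num.sqrt n%:R * m^-1 * (e * `|m - Fn n w q|).
Proof.
move=> Fl Fr; set Q := empirical_probability (fun i => X i w) n0.
have := @hinge_max_near _ _ Q x m m0 m1 q e Fl Fr.
rewrite -[sqdist_cdf Q x q]/(Fn n w q).
set qn := sqdist_quantile Q x m.
have nR0 : 0 < n%:R :> R by rewrite ltr0n.
have sn : Num.sqrt n%:R * Num.sqrt n%:R = n%:R :> R by rewrite -expr2 sqr_sqrtr ?ltW.
have -> : Z n w - S n w = Num.sqrt n%:R * m^-1 *
    (m * qn - hinge_mean Q x qn - (m * q - hinge_mean Q x q)).
  rewrite /Z empirical_dtm !dtm_sqrE// -/Q -/qn -/q.
  rewrite /S (_ : (Num.sqrt n%:R)^-1 = Num.sqrt n%:R / n%:R); last first.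
    by rewrite -[X in _ / X]sn invfM mulrA mulfV ?mul1r// gt_eqF// sqrtr_gt0.
  rewrite /phi -mulr_sumr sumrB sumr_const_nat subn0 big_mkord.
  rewrite [hinge_mean Q x q]empirical_hinge_mean.
  rewrite -[hinge_mean P x q *+ n]mulr_natl.
  by field; rewrite !gt_eqF.
have k0 : 0 <= Num.sqrt n%:R * m^-1 by rewrite mulr_ge0 ?sqrtr_ge0// invr_ge0 ltW.
by move=> /andP[l u]; rewrite mulr_ge0//= ler_wpM2l.
Qed.

Let empirical_cdf_var n t : (0 < n)%N ->
  bounded_mfun (fun w => (Fn n w t - F t) ^+ 2) /\
  \int[Pr]_w ((Fn n w t - F t) ^+ 2) <= n%:R^-1.
Proof.
move=> n0; have nR0 : 0 < n%:R :> R by rewrite ltr0n.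
pose chi y := \1_[set z | sqdist x z <= t] y - F t.
have b1 : bounded_mfun (\1_[set z | sqdist x z <= t] : d.-tuple R -> R).
  exact: (bounded_mfun_sublevel (measurable_sqdist x)).
have bchi : bounded_mfun chi by apply: bounded_mfunB => //; exact: bounded_mfun_cst.
have chi0 : \int[P]_y chi y = 0.
  rewrite expectB//; last exact: bounded_mfun_cst.
  by rewrite expect_cst -sqdist_cdfE subrr.
have FnE w : (Fn n w t - F t) ^+ 2 =
    n%:R^-1 ^+ 2 * (\sum_(0 <= j < n) chi (X j w)) ^+ 2.
  rewrite -exprMn; congr (_ ^+ 2).
  rewrite /Fn empirical_cdf// sumrB sumr_const_nat subn0 big_mkord mulrBr.
   by rewrite -[F t *+ n]mulr_natl mulrA mulVf ?mul1r// gt_eqF.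
have bS := bounded_mfunX 2 (bounded_mfun_iid_sum X (index_iota 0 n) bchi).
split.
  under eq_fun do rewrite FnE.
  by apply: bounded_mfunM => //; exact: bounded_mfun_cst.
under eq_Rintegral do rewrite FnE.
rewrite expectZ// (expect_sum_sqr Xiid) ?iota_uniq// size_iota subn0.
have nV : 0 <= n%:R^-1 :> R by rewrite invr_ge0 ltW.
rewrite expr2 -mulrA mulKf ?gt_eqF// ler_piMr//.
rewrite -[leRHS](expect_cst P); apply: expect_le => [||y].
- exact: bounded_mfunX.
- exact: bounded_mfun_cst.
have := sqdist_cdf_ge0 P x t; have := sqdist_cdf_le1 P x t; rewrite -/F => h1 h0.
rewrite -(real_normK (num_real (chi y))) expr_le1// ler_norml /chi indicE.
by case: (_ \in _) => /=; lra.
Qed.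

Let N a := fine (normal_prob 0 s `]-oo, a]%classic).
Let p n t := fine (Pr [set w | Z n w <= t]).

Let mZt n t : measurable [set w | Z n w <= t].
Proof.
have := mZ n measurableT (measurable_itv `]-oo, t]).
by rewrite setTI; congr measurable.
Qed.

Let bramp n a e : 0 < e -> bounded_mfun (fun w => ramp a e (S n w)).
Proof.
move=> e0; have bS : bounded_mfun (S n).
  apply: bounded_mfunM; first exact: bounded_mfun_cst.
  exact: bounded_mfun_iid_sum.
split; first by apply: measurableT_comp (measurable_ramp _ e0) _; case: bS.
by exists 1 => w; have /andP[h0 h1] := ramp01 a e (S n w); rewrite ger0_norm.
Qed.

Let bZt n t : bounded_mfun (\1_[set w | Z n w <= t] : Omega -> R).
Proof. exact: bounded_mfun_indic. Qed.

(* The remainder [Z n - S n] exceeds [eta] only if one of [Fn n (q - e)],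
   [Fn n (q + e)], [Fn n q] is far from its mean; [U] adds up the three
   corresponding Chebyshev majorants. *)
Let U n e eta w :=
  (m - F (q - e)) ^- 2 * (Fn n w (q - e) - F (q - e)) ^+ 2 +
  (F (q + e) - m) ^- 2 * (Fn n w (q + e) - F (q + e)) ^+ 2 +
  n%:R * (e / (m * eta)) ^+ 2 * (Fn n w q - F q) ^+ 2.

Let U_ge0 n e eta w : 0 <= U n e eta w.
Proof.
apply: addr_ge0; first apply: addr_ge0; apply: mulr_ge0; rewrite ?sqr_ge0//.
- by rewrite invr_ge0 sqr_ge0.
- by rewrite invr_ge0 sqr_ge0.
- by apply: mulr_ge0 => //; exact: sqr_ge0.
Qed.

Let Fq : F q = m. Proof. exact: sqdist_cdf_quantile. Qed.

Let F_strict e : 0 < e -> F (q - e) < m < F (q + e).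
Proof.
rewrite -Fq => e0; apply: derive_gt0_strict => // a b.
exact: sqdist_cdf_nd.
Qed.

(** If the bracketing of [m] fails at [q - e] or [q + e], then [Fn] deviates there by at least the
    gap between [F] and [m]. If it holds and the remainder exceeds [eta], then
    [sqrt n * e * |m - Fn q| >= m * eta]. *)
Let remainder_U n (n0 : (0 < n)%N) e eta w : 0 < e -> 0 < eta ->
  S n w <= Z n w <= S n w + eta \/ 1 <= U n e eta w.
Proof.
move=> e0 eta0; have /andP[Fl Fr] := F_strict e0.
have nR0 : 0 < n%:R :> R by rewrite ltr0n.
have term_ge1 (c D : R) : 0 < c -> c <= `|D| -> 1 <= c ^- 2 * D ^+ 2.
  move=> c0 cD; rewrite mulrC ler_pdivlMr ?exprn_gt0// mul1r.
  by rewrite -(real_normK (num_real D)) lerXn2r// nnegrE ltW.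
have term_ge0 (c D : R) : 0 <= c ^- 2 * D ^+ 2.
  by rewrite mulr_ge0 ?sqr_ge0// invr_ge0 sqr_ge0.
have term3_ge0 : 0 <= n%:R * (e / (m * eta)) ^+ 2 * (Fn n w q - F q) ^+ 2.
  by apply: mulr_ge0; [apply: mulr_ge0 => //; exact: sqr_ge0|exact: sqr_ge0].
have [Fnl|Fnl] := leP m (Fn n w (q - e)).
  right; rewrite /U -addrA; apply: ler_wpDr; first exact: addr_ge0.
  apply: term_ge1; first by rewrite subr_gt0.
  by apply: le_trans (ler_norm _); rewrite lerD2r.
have [Fnr|Fnr] := ltP (Fn n w (q + e)) m.
  right; rewrite /U addrAC; apply: ler_wpDl; first exact: addr_ge0.
  apply: term_ge1; first by rewrite subr_gt0.
  by rewrite distrC; apply: le_trans (ler_norm _); rewrite lerD2l lerN2 ltW.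
have /andP[r0 r1] := remainder n0 Fnl Fnr.
have [reta|reta] := leP (Z n w - S n w) eta.
  by left; rewrite -subr_ge0 r0/= -lerBlDl.
right; rewrite /U; apply: ler_wpDl; first exact: addr_ge0.
have : 1 <= Num.sqrt n%:R * (e / (m * eta)) * `|m - Fn n w q|.
  rewrite [leRHS](_ : _ = Num.sqrt n%:R * m^-1 * (e * `|m - Fn n w q|) / eta).
    by rewrite ler_pdivlMr// mul1r (le_trans (ltW reta)).
  by field; rewrite !gt_eqF.
move=> h1; apply: (le_trans h1).
(* A number that is at least 1 is at most its square, here the third term of [U]. *)
rewrite [leRHS](_ : _ = (Num.sqrt n%:R * (e / (m * eta)) * `|m - Fn n w q|) ^+ 2).
  by rewrite expr2 ler_peMr// (le_trans ler01).
rewrite [RHS](_ : _ = Num.sqrt n%:R ^+ 2 * (e / (m * eta)) ^+ 2 *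
  `|m - Fn n w q| ^+ 2); last by ring.
by rewrite sqr_sqrtr ?(ltW nR0)// Fq real_normK ?num_real// -[X in _ = _ * X]sqrrN opprB.
Qed.

(** In the third term the factor [n] cancels the variance bound [1 / n]. What is left does not tend
    to 0 with [n], but is made small through [e]. *)
Let U_mean n (n0 : (0 < n)%N) e eta : bounded_mfun (U n e eta) /\
  \int[Pr]_w U n e eta w <=
  ((m - F (q - e)) ^- 2 + (F (q + e) - m) ^- 2) / n%:R + (e / (m * eta)) ^+ 2.
Proof.
have nR0 : 0 < n%:R :> R by rewrite ltr0n.
have bt (c : R) t : bounded_mfun (fun w => c * (Fn n w t - F t) ^+ 2).
  apply: bounded_mfunM; first exact: bounded_mfun_cst.
  exact: (empirical_cdf_var t n0).1.
have st (c : R) t : 0 <= c ->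
    \int[Pr]_w (c * (Fn n w t - F t) ^+ 2) <= c / n%:R.
  move=> c0; rewrite expectZ; last exact: (empirical_cdf_var t n0).1.
  by rewrite ler_wpM2l//; exact: (empirical_cdf_var t n0).2.
split; first by apply: bounded_mfunD => //; exact: bounded_mfunD.
rewrite expectD//; last exact: bounded_mfunD.
rewrite expectD//.
have c0 (c : R) : 0 <= c ^- 2 by rewrite invr_ge0 sqr_ge0.
rewrite mulrDl; apply: lerD; first by apply: lerD; exact: st.
apply: le_trans (st _ q _) _; first by apply: mulr_ge0 => //; exact: sqr_ge0.
by rewrite mulrAC mulfV ?mul1r// gt_eqF.
Qed.

(** Where [U < 1], [Z <= t] implies [S <= t]: the remainder is nonnegative, so the ramp needs no
    shift on this side. *)
Let upper n t e eta eta' : (0 < n)%N -> 0 < e -> 0 < eta -> 0 < eta' ->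
  p n t <= \int[Pr]_w ramp t eta (S n w) + \int[Pr]_w U n e eta' w.
Proof.
move=> n0 e0 eta0 eta'0; have bU := (U_mean n0 e eta').1.
rewrite /p -(expect_indic Pr (mZt n t)) -expectD//; last exact: bramp.
apply: expect_le => // [|w]; first by apply: bounded_mfunD => //; exact: bramp.
have /andP[h0 h1] := ramp01 t eta (S n w).
have U0 : 0 <= U n e eta' w.
  exact: U_ge0.
rewrite indicE; have [|_] := boolP (w \in _); last exact: addr_ge0.
rewrite inE/= => Zt; have [/andP[SZ _]|U1] := remainder_U n0 w e0 eta'0; last first.
  by rewrite ler_wpDl.
by rewrite (ramp_left eta0 (le_trans SZ Zt)) ler_wpDr.
Qed.

(** The shift is [2 eta]: one [eta] for the width of the ramp, one for the remainder. *)
Let lower n t e eta : (0 < n)%N -> 0 < e -> 0 < eta ->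
  \int[Pr]_w ramp (t - (eta + eta)) eta (S n w) - \int[Pr]_w U n e eta w <= p n t.
Proof.
move=> n0 e0 eta0; have bU := (U_mean n0 e eta).1.
rewrite /p -(expect_indic Pr (mZt n t)) -expectB//; last exact: bramp.
apply: expect_le => // [|w]; first by apply: bounded_mfunB => //; exact: bramp.
have /andP[h0 h1] := ramp01 (t - (eta + eta)) eta (S n w).
have U0 : 0 <= U n e eta w.
  exact: U_ge0.
rewrite indicE; have [_|] := boolP (w \in _); first by rewrite /=; lra.
rewrite notin_setE/= => /negP; rewrite -ltNge => tZ.
have [/andP[_ ZS]|U1] := remainder_U n0 w e0 eta0; last lra.
rewrite ramp_right//; lra.
Qed.

Let clt_ramp t eta : 0 < eta ->
  \int[Pr]_w ramp t eta (S n w) @[n --> \oo] -->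
  \int[lebesgue_measure]_y (ramp t eta y * normal_pdf 0 s y).
Proof.
move=> eta0; apply: (clt_lipschitz Xiid bphi phi0 _ phi2 (L := eta^-1)).
- by rewrite gt_eqF.
- exact: ramp01.
- by move=> y z; exact: ramp_lip.
Qed.

Lemma dtm_cdf_cvg t : {for t, continuous N} -> p n t @[n --> \oo] --> N t.
Proof.
move=> Nc.
apply/cvgrPdist_le => /= r r0.
have r3 : 0 < r / 3 by rewrite divr_gt0.
move/cvgrPdist_le : Nc => /(_ _ r3)[del /= del0 Ndel].
(* Both [t - 2 eta] and [t + eta] then lie within [del] of [t]. *)
pose eta := del / 3.
have eta0 : 0 < eta by rewrite divr_gt0.
have Nl : N t - r / 3 <= N (t - (eta + eta)).
  have := Ndel (t - (eta + eta)); rewrite /= opprB addrC subrK.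
  rewrite gtr0_norm ?addr_gt0// => /(_ _)/(le_trans (ler_norm _)) => h.
  by rewrite lerBlDl -lerBlDr; apply: h; rewrite /eta; lra.
have Nr : N (t + eta) <= N t + r / 3.
  have := Ndel (t + eta); rewrite /= opprD addrA subrr sub0r normrN gtr0_norm//.
  rewrite distrC => /(_ _)/(le_trans (ler_norm _)) => h.
  by rewrite -lerBlDl; apply: h; rewrite /eta; lra.
(* The tolerance [r] is shared equally by the continuity of [N], the convergence of the ramps and
   the mean of [U]. The share of [U] is halved: [e = m eta k] makes
   [(e / (m eta))^2 = k^2 <= r / 6], and a large [n] takes care of the rest. *)
pose k := Num.min 1 (r / 6).
have k0 : 0 < k by rewrite lt_min ltr01 divr_gt0.
have k2 : k ^+ 2 <= r / 6.
  apply: (@le_trans _ _ k); last by rewrite /k ge_min lexx orbT.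
  by rewrite expr2 ler_piMl ?(ltW k0)// /k ge_min lexx.
pose e := m * eta * k.
have e0 : 0 < e by rewrite !mulr_gt0.
have ek : e / (m * eta) = k by rewrite /e; field; rewrite !gt_eqF.
pose C := (m - F (q - e)) ^- 2 + (F (q + e) - m) ^- 2.
have C0 : 0 <= C by rewrite addr_ge0// invr_ge0 sqr_ge0.
have UM n : (0 < n)%N -> C / (r / 6) <= n%:R -> \int[Pr]_w U n e eta w <= r / 3.
  move=> n0 Cn; have nR0 : 0 < n%:R :> R by rewrite ltr0n.
  apply: le_trans (U_mean n0 e eta).2 _; rewrite ek -/C.
  have : C / n%:R <= r / 6.
    by rewrite ler_pdivrMr// mulrC -ler_pdivrMr// divr_gt0.
  lra.
have /cvgrPdist_le/(_ _ r3) ramp_u := @clt_ramp t eta eta0.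
have /cvgrPdist_le/(_ _ r3) ramp_l := @clt_ramp (t - (eta + eta)) eta eta0.
near=> n.
have n0 : (0 < n)%N by near: n; exact: nbhs_infty_gt.
have /(UM n n0) Ur : C / (r / 6) <= n%:R by near: n; exact: nbhs_infty_ger.
have up := upper t n0 e0 eta0 eta0.
have lo := lower t n0 e0 eta0.
have R1 := normal_ramp_le s t eta0.
have R2 := normal_ramp_ge s (t - (eta + eta)) eta0.
rewrite -/(N _) in R1; rewrite -/(N _) in R2.
have := le_trans R1 Nr; have := le_trans Nl R2.
have : `|\int[lebesgue_measure]_y (ramp t eta y * normal_pdf 0 s y) -
    \int[Pr]_w ramp t eta (S n w)| <= r / 3.
  by near: n; exact: ramp_u.
have : `|\int[lebesgue_measure]_y (ramp (t - (eta + eta)) eta y * normal_pdf 0 s y) -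
    \int[Pr]_w ramp (t - (eta + eta)) eta (S n w)| <= r / 3.
  by near: n; exact: ramp_l.
rewrite !ler_norml => /andP[? ?] /andP[? ?] ? ?.
by apply/andP; split; lra.
Unshelve. all: by end_near. Qed.

Lemma dtm_cvg_in_distribution : cvg_in_distribution Pr Z (normal_prob 0 s).
Proof.
split => // t tc.
have fin a : normal_prob 0 s `]-oo, a]%classic \is a fin_num.
  by rewrite fin_num_measure.
have Nc : {for t, continuous N}.
  by apply: fine_cvg; rewrite fineK; [exact: tc|exact: fin].
rewrite -[X in _ --> X]fineK; last exact: fin.
apply/fine_cvgP; split; last exact: dtm_cdf_cvg.
by apply: nearW => n; rewrite fin_num_measure.
Qed.

End dtm_clt.

Theorem theorem5 (R : realType) (d : nat) (P : probability (d.-tuple R) R)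
    (disp : measure_display) (Omega : measurableType disp)
    (Pr : probability Omega R) (X : nat -> {RV Pr >-> d.-tuple R})
    (m : R) (x : d.-tuple R) :
  0 < m -> m < 1 ->
  iid P X ->
  derivable (sqdist_cdf P x) (sqdist_quantile P x m) 1 ->
  0 < (sqdist_cdf P x)^`()%classic (sqdist_quantile P x m) ->
  cvg_in_distribution Pr
    (fun n w => Num.sqrt n%:R *
       (dtm (empirical (fun i => X i w) n) m x ^+ 2 - dtm P m x ^+ 2))
    (normal_prob 0 (Num.sqrt (dtm_variance P m x))).
Proof. exact: dtm_cvg_in_distribution. Qed.
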